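(* Let $G \cong C_2 \oplus C_2 \oplus C_{2n}$, where $n \ge 2$ is an integer. A sequence $S$ over $G$ of length $|S| = \eta(G) - 1 = 2n+3$ contains no short zero-sum subsequence if and only if there exists a basis $\{f_1,f_2,f_3\}$ of $G$ with $\operatorname{ord}(f_1) = \operatorname{ord}(f_2) = 2$ and $\operatorname{ord}(f_3) = 2n$ such that $S$ is equal to one of the following sequences: (η1) $f_3^{2n-1-2v} (f_3+f_2)^{2v+1} f_2 (a f_3 + f_1)\bigl((1-a)f_3 + f_2 + f_1\bigr)$ with $v \in [0,n-1]$ and $a \in [2,n-1]$; (η2) $f_3^{2n-1} (a f_3 + f_2)\bigl((1-a) f_3 + f_2\bigr)(b f_3 + f_1)\bigl((1-b) f_3 + f_1\bigr)$ with $a,b \in [2,n-1]$ and $a \ge b$; (η3) $\prod_{i=1}^{2n+1} (f_3 + d_i)\, f_2 f_1$, where $S' = \prod_{i=1}^{2n+1} d_i$ is a sequence over the subgroup $\langle f_1, f_2\rangle$ with $\sigma(S') \notin \operatorname{supp}(S')$.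
   Context: $C_m$ denotes a cyclic group of order $m$; $\operatorname{ord}(g)$ is the order of $g$; $[a,b]=\{z\in\mathbb{Z}: a\le z\le b\}$. A basis of a finite abelian group is an independent generating set, where $g_1,\dots,g_k$ are independent if $\sum a_i g_i = 0$ with integers $a_i$ implies $a_i g_i = 0$ for all $i$. A sequence over $G$ is an element of the free abelian monoid over $G$ (finite multiset, written multiplicatively; $g^k$ means $g$ repeated $k$ times). For $S = g_1\cdots g_\ell$: $|S|=\ell$, $\sigma(S)=\sum g_i$, $\operatorname{supp}(S)$ is the set of distinct elements occurring in $S$. A subsequence is a sub-multiset. A zero-sum sequence is one with $\sigma = 0$; a sequence is short if it is nonempty and has length at most $\exp(G)$ (the exponent of $G$, here $2n$). $\eta(G)$ is the smallest integer $\ell$ such that every sequence over $G$ of length at least $\ell$ has a short zero-sum subsequence; for this $G$, $\eta(G) = 2n+4$. *)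

(* Defs.v *)
From HB Require Import structures.
From mathcomp Require Import all_boot all_order all_algebra.
From mathcomp Require Import all_fingroup all_solvable.
From mathcomp Require Import finmap multiset.

Set Implicit Arguments.
Unset Strict Implicit.
Unset Printing Implicit Defensive.

Import GRing.Theory.
Local Open Scope ring_scope.

Section Sequences.
Variable G : finZmodType.

(* Sequences over G are the elements of {mset G}; through the coercion to seq,
   size and iterated sums count multiplicities. *)

Definition mset_sum (S : {mset G}%mset) : G := \sum_(g <- S) g.

Definition short (S : {mset G}%mset) : Prop :=
  (1 <= size S)%N /\ (size S <= exponent [set: G])%N.

Definition has_short_zero_sum (S : {mset G}%mset) : Prop :=
  exists T : {mset G}%mset, [/\ (T `<=` S)%mset, short T & mset_sum T = 0].

Definition is_eta (l : nat) : Prop :=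
  (forall S : {mset G}%mset, (l <= size S)%N -> has_short_zero_sum S) /\
  (forall m : nat,
     (forall S : {mset G}%mset, (m <= size S)%N -> has_short_zero_sum S) ->
     (l <= m)%N).

(* Independence in the torsion sense: only the terms must vanish, not the
   coefficients. *)
Definition independent (k : nat) (f : k.-tuple G) : Prop :=
  forall a : 'I_k -> int,
    \sum_(i < k) tnth f i *~ a i = 0 -> forall i, tnth f i *~ a i = 0.

Definition generating (k : nat) (f : k.-tuple G) : Prop :=
  forall g : G, exists a : 'I_k -> int, g = \sum_(i < k) tnth f i *~ a i.

Definition is_basis (k : nat) (f : k.-tuple G) : Prop :=
  independent f /\ generating f.

Definition eta1 (n : nat) (f1 f2 f3 : G) (S : {mset G}%mset) : Prop :=
  exists v a : nat,
    [/\ (0 <= v <= n - 1)%N, (2 <= a <= n - 1)%N &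
        S = seq_mset (nseq (2 * n - 1 - 2 * v) f3
                      ++ nseq (2 * v + 1) (f3 + f2)
                      ++ [:: f2; f3 *~ a%:Z + f1;
                             f3 *~ (1 - a%:Z) + f2 + f1])].

Definition eta2 (n : nat) (f1 f2 f3 : G) (S : {mset G}%mset) : Prop :=
  exists a b : nat,
    [/\ (2 <= a <= n - 1)%N, (2 <= b <= n - 1)%N, (b <= a)%N &
        S = seq_mset (nseq (2 * n - 1) f3
                      ++ [:: f3 *~ a%:Z + f2; f3 *~ (1 - a%:Z) + f2;
                             f3 *~ b%:Z + f1; f3 *~ (1 - b%:Z) + f1])].

Definition eta3 (n : nat) (f1 f2 f3 : G) (S : {mset G}%mset) : Prop :=
  exists S' : {mset G}%mset,
    [/\ size S' = (2 * n + 1)%N,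
        forall d, d \in S' -> d \in <<[set f1; f2]>>%g,
        mset_sum S' \notin S' &
        S = seq_mset ([seq f3 + d | d <- S'] ++ [:: f2; f1])].

End Sequences.

(* Main.v *)
Require Import Defs.
From HB Require Import structures.
From mathcomp Require Import all_boot all_order all_algebra.
From mathcomp Require Import all_fingroup all_solvable.
From mathcomp Require Import finmap multiset.
From mathcomp Require Import zify.

Set Implicit Arguments.
Unset Strict Implicit.
Unset Printing Implicit Defensive.

Import GRing.Theory.
Local Open Scope ring_scope.

(** Work modulo 2G: G/2G has order 8 and K = 2G is cyclic of order n. A block is
    a nonempty subsequence with sum in K. Disjoint blocks of total length at
    most 2n have sums forming a zero-sum free sequence over K, so there are at
    most n - 1 of them, and if there are n - 1 of them then each sum is
    determined by the others. Pairing the terms of S by their class modulo 2G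
    therefore leaves exactly five terms R with distinct nonzero classes, and all
    n - 1 pairs, as well as all blocks of length 3 and 4 in R, have the same
    sum e. Exchanging a term of a pair with the term of R of the same class shows
    that every pair has the form x x with x in R and 2x = e; the blocks in R give
    R = f g (f - g) h (f - h) with 2f = e. This normal form, which is also
    sufficient, splits into the three families according to whether 2g = 2f
    and 2h = 2f. *)

(** * Zero-sum free sequences *)

Section ZeroSumFree.
Variable G : finZmodType.
Implicit Types (x y : G) (xs ys : seq G) (K : {set G}).

Definition zero_sum_free xs :=
  forall ys, subseq ys xs -> ys != [::] -> \sum_(y <- ys) y != 0.

Fixpoint subsums xs : {set G} :=
  if xs is x :: xs' then subsums xs' :|: [set x + y | y in subsums xs']
  else [set 0].

Lemma subsumsP xs y :
  y \in subsums xs -> exists2 ys, subseq ys xs & y = \sum_(z <- ys) z.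
Proof.
elim: xs y => [|x xs IH] y /=.
  by rewrite inE => /eqP->; exists [::]; rewrite ?big_nil.
rewrite inE => /orP[/IH[ys sys ->]|/imsetP[z /IH[ys sys ->] ->]].
  by exists ys => //; apply: subseq_trans sys (subseq_cons _ _).
by exists (x :: ys); rewrite /= ?eqxx // big_cons.
Qed.

Lemma subsums0 xs : 0 \in subsums xs.
Proof. by elim: xs => [|x xs IH] /=; rewrite !inE ?IH. Qed.

Lemma zero_sum_free_behead x xs : zero_sum_free (x :: xs) -> zero_sum_free xs.
Proof. by move=> zf ys s; apply: zf; apply: subseq_trans s (subseq_cons _ _). Qed.

Lemma zero_sum_free_opp x xs : zero_sum_free (x :: xs) -> - x \notin subsums xs.
Proof.
move=> zf; apply/negP => /subsumsP[ys sys e].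
have : \sum_(z <- x :: ys) z != 0 by apply: zf; rewrite //= eqxx.
by rewrite big_cons -e subrr eqxx.
Qed.

(** Each new term x enlarges the set of subsums. Otherwise translation by x would permute this set;
    as it contains 0, it would also contain -x, giving a zero sum. *)
Lemma card_subsums xs : zero_sum_free xs -> (size xs < #|subsums xs|)%N.
Proof.
elim: xs => [|x xs IH] zf /=; first by rewrite cards1.
have {}IH := IH (zero_sum_free_behead zf).
apply: (leq_ltn_trans IH); apply: proper_card; rewrite properE subsetUl /=.
rewrite subUset subxx /=; apply/negP => sub.
have e : [set x + y | y in subsums xs] = subsums xs.
  by apply/eqP; rewrite eqEcard sub card_imset ?leqnn //; apply: addrI.
have := subsums0 xs; rewrite -e => /imsetP[y yin /esym/eqP].
by rewrite addrC addr_eq0 => /eqP yx; have := zero_sum_free_opp zf; rewrite -yx yin.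
Qed.

Section InSubgroup.
Variable K : {set G}.
Hypotheses (K0 : 0 \in K) (KD : forall x y, x \in K -> y \in K -> x + y \in K)
  (KN : forall x, x \in K -> - x \in K).

Lemma subsums_sub xs : {subset xs <= K} -> subsums xs \subset K.
Proof.
elim: xs => [|x xs IH] sK /=; first by rewrite sub1set.
have sK' : subsums xs \subset K.
  by apply: IH => y yin; apply: sK; rewrite inE yin orbT.
rewrite subUset sK' /=; apply/subsetP => _ /imsetP[y /(subsetP sK') yK ->].
by apply: KD yK; apply: sK; rewrite mem_head.
Qed.

(** This is the bound |K| for the Davenport constant of K. *)
Lemma size_zero_sum_free xs :
  zero_sum_free xs -> {subset xs <= K} -> (size xs < #|K|)%N.
Proof.
by move=> /card_subsums lt /subsums_sub/subset_leq_card; apply: leq_trans.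
Qed.

(* A zero-sum free sequence of length |K| - 1 has at least |K| - 1 subsums
   after removing one term, so that term is determined by the others. *)
Lemma zero_sum_free_exchange x y xs :
  zero_sum_free (x :: xs) -> zero_sum_free (y :: xs) ->
  {subset x :: y :: xs <= K} -> (#|K| <= (size xs).+2)%N -> x = y.
Proof.
move=> zx zy sK cK; apply/eqP; apply/negPn/negP => nxy.
have lt := card_subsums (zero_sum_free_behead zx).
have nx := zero_sum_free_opp zx; have ny := zero_sum_free_opp zy.
(* Besides at least |xs| + 1 subsums, K contains -x and -y, one element more than its size
   allows. *)
have sub : - x |: (- y |: subsums xs) \subset K.
  rewrite !subUset !sub1set !KN ?sK ?inE ?eqxx ?orbT //=.
  by apply: subsums_sub => z zin; apply: sK; rewrite !inE zin !orbT.
have := subset_leq_card sub; rewrite !cardsU1 ny !inE negb_or nx.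
rewrite (inj_eq oppr_inj) nxy /=.
by move=> /leq_trans/(_ cK); rewrite !add1n !ltnS leqNgt lt.
Qed.

End InSubgroup.
End ZeroSumFree.

(** * Classes modulo 2G *)

(* Models G / 2G, an elementary abelian group of order 8; below, [cl] is the
   projection onto it, and its kernel [K] is 2G. *)
Local Notation V := (bool * bool * bool)%type.

Section Classes.

Lemma addVV (c : V) : c + c = 0.
Proof. by case: c => [[[] []] []]. Qed.

Definition nonzeros : seq V := [:: (true, false, false); (false, true, false);
  (false, false, true); (true, true, false); (true, false, true);
  (false, true, true); (true, true, true)].

Definition allV : seq V := 0 :: nonzeros.

Lemma memV (c : V) : c \in allV.
Proof. by case: c => [[[] []] []]. Qed.

Lemma perm_nonzeros (L : seq V) : uniq L -> 0 \notin L ->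
  perm_eq L [seq c <- nonzeros | c \in L].
Proof.
move=> uL L0; apply: uniq_perm => //; first by rewrite filter_uniq.
move=> c; rewrite mem_filter; case cL: (c \in L) => //=.
have : c != 0 by apply: contraNneq L0 => <-.
by move: c {cL} => [[[] []] []].
Qed.

Lemma size_uniq_nonzero (L : seq V) : uniq L -> 0 \notin L -> (size L <= 7)%N.
Proof.
by move=> uL /(perm_nonzeros uL)/perm_size->; rewrite size_filter (count_size _ nonzeros).
Qed.

Let masks : seq bitseq :=
  iter 7 (fun ms => map (cons true) ms ++ map (cons false) ms) [:: [::]].

(** A set of nonzero classes is a mask of the fixed list [nonzeros], so a property of such sets up
    to order is settled by 128 evaluations. *)
Lemma nonzero_mask (L : seq V) (P : pred (seq V)) :
  uniq L -> 0 \notin L ->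
  all (fun m => P (mask m nonzeros)) masks -> exists2 M, perm_eq L M & P M.
Proof.
move=> uL L0 /allP aP; exists [seq c <- nonzeros | c \in L].
  exact: perm_nonzeros.
rewrite filter_mask; apply: aP; rewrite /nonzeros /=.
by do 7! [case: (_ \in L)].
Qed.

Let find3 (P : V -> V -> V -> bool) : bool :=
  has (fun x => has (fun y => has (P x y) nonzeros) nonzeros) nonzeros.

Let find3P P : find3 P -> exists x y z, P x y z.
Proof. by move=> /hasP[x _ /hasP[y _ /hasP[z _ p]]]; exists x, y, z. Qed.

(** In the Fano plane of nonzero classes, r is the third point on the line through the two missing
    classes; the other two lines through r make up the five. *)
Lemma five_classes (L : seq V) : uniq L -> 0 \notin L -> size L = 5 ->
  exists r u v, perm_eq L [:: r; u; u + r; v; v + r].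
Proof.
move=> uL L0 /eqP s5.
have [|M pLM] := @nonzero_mask L (fun M => (size M == 5) ==>
  find3 (fun r u v => perm_eq M [:: r; u; u + r; v; v + r])) uL L0.
  by vm_compute.
rewrite -(perm_size pLM) s5 /= => /find3P[r [u [v pM]]].
by exists r, u, v; apply: perm_trans pM.
Qed.

(** Here q is the missing class, x, y, x + y form a line avoiding q, and the other three classes are
    its translate by q. *)
Lemma six_classes (L : seq V) : uniq L -> 0 \notin L -> size L = 6 ->
  exists x y q, perm_eq L [:: x; y; x + y; x + q; y + q; x + y + q].
Proof.
move=> uL L0 /eqP s6.
have [|M pLM] := @nonzero_mask L (fun M => (size M == 6) ==> find3 (fun x y q =>
  perm_eq M [:: x; y; x + y; x + q; y + q; x + y + q])) uL L0.
  by vm_compute.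
rewrite -(perm_size pLM) s6 /= => /find3P[x [y [q pM]]].
by exists x, y, q; apply: perm_trans pM.
Qed.

End Classes.

(** * Blocks *)

(* Reduces [perm_eq] to linear arithmetic on the counts of an arbitrary predicate. *)
Ltac perm_count :=
  let a := fresh "a" in
  apply/seq.permP; intro a;
  repeat match goal with H : is_true (perm_eq _ _) |- _ =>
    first [generalize (elimT seq.permP H a); clear H | clear H] end;
  rewrite /= ?map_cat ?flatten_cat ?count_cat /= ?count_cat /=;
  repeat match goal with |- context [nat_of_bool ?b] =>
    let k := fresh "k" in set k := nat_of_bool b; clearbody k end;
  repeat match goal with |- context [@count ?U a ?l] =>
    let k := fresh "k" in set k := (@count U a l); clearbody k end;
  clear; lia.

Lemma perm_map_lift (T T' : eqType) (f : T -> T') (s : seq T) (t : seq T') :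
  perm_eq (map f s) t -> exists2 s', perm_eq s s' & map f s' = t.
Proof.
case: s => [|x0 s]; first by rewrite perm_sym => /perm_nilP->; exists [::].
rewrite perm_sym => /(perm_iotaP (f x0))[Is pI eI].
exists [seq nth x0 (x0 :: s) i | i <- Is].
  rewrite perm_sym; apply/(perm_iotaP x0); exists Is => //.
  by rewrite size_map in pI.
rewrite eI -map_comp; apply/eq_in_map => i iI /=.
have : (i < (size s).+1)%N.
  by move: iI; rewrite (perm_mem pI) size_map mem_iota.
by case: i {iI} => //= i lt; rewrite (nth_map x0).
Qed.

(** The triples are the four Fano lines avoiding q, the quadruples the complements of the three
    lines through q. The trailing zeros match the unfolding of sums over explicit lists. *)
Lemma six_class_sums (x y q : V) :
  [/\ x + (y + (x + y + 0)) = 0, x + (y + q + (x + y + q + 0)) = 0,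
      x + q + (y + (x + y + q + 0)) = 0 &
  [/\ x + q + (y + q + (x + y + 0)) = 0, x + (x + q + (y + (y + q + 0))) = 0,
      x + (x + q + (x + y + (x + y + q + 0))) = 0 &
      y + (y + q + (x + y + (x + y + q + 0))) = 0]].
Proof.
by move: x y q => [[[] []] []] [[[] []] []] [[[] []] []]; split=> //; split.
Qed.

Definition pair_seq (T : Type) (p : T * T) := [:: p.1; p.2].

Lemma size_flatten_pairs (T : Type) (ps : seq (T * T)) :
  size (flatten (map (@pair_seq T) ps)) = (2 * size ps)%N.
Proof. by elim: ps => //= p ps ->; lia. Qed.

Section Blocks.
Variables (n : nat) (G : finZmodType) (cl : {additive G -> V}).
Let K : {set G} := [set g | cl g == 0].
Hypotheses (n_gt1 : (1 < n)%N) (cardK : #|K| = n).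
Implicit Types (s t u b : seq G) (bs : seq (seq G)) (ps : seq (G * G)).

Let K0 : 0 \in K.
Proof. by rewrite inE raddf0. Qed.
Let KD x y : x \in K -> y \in K -> x + y \in K.
Proof. by rewrite !inE raddfD => /eqP-> /eqP->; rewrite addr0. Qed.
Let KN x : x \in K -> - x \in K.
Proof. by rewrite !inE raddfN => /eqP->; rewrite oppr0. Qed.

Definition no_short_zero_sum s := forall t u,
  perm_eq (t ++ u) s -> (0 < size t <= 2 * n)%N -> \sum_(x <- t) x != 0.

Definition block b := (b != [::]) && (cl (\sum_(x <- b) x) == 0).

Lemma block_sums_in bs : all block bs ->
  {subset [seq \sum_(x <- b) x | b <- bs] <= K}.
Proof.
by move=> /allP ab _ /mapP[b /ab /andP[_ b0] ->]; rewrite inE.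
Qed.

(** Concatenating the blocks of a zero-sum selection would give a zero-sum subsequence of s of
    length at most 2n. *)
Lemma blocks_zero_sum_free s bs u :
  no_short_zero_sum s -> perm_eq (flatten bs ++ u) s -> all block bs ->
  (size (flatten bs) <= 2 * n)%N ->
  zero_sum_free [seq \sum_(x <- b) x | b <- bs].
Proof.
move=> ns ps ab sz ys /subseqP[m sm ->]; rewrite -map_mask => ne.
have [cs pcs] := perm_to_subseq (mask_subseq m bs).
have pf := perm_flatten pcs; rewrite flatten_cat in pf.
rewrite big_map -big_flatten; apply: (ns _ (flatten cs ++ u)).
  by rewrite catA -(permPr ps) perm_cat2r perm_sym.
have := perm_size pf; rewrite size_cat => szf.
apply/andP; split; last by rewrite (leq_trans _ sz) // szf leq_addr.
have := mask_subseq m bs; case: (mask m bs) ne => // b bs' _ /mem_subseq sub /=.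
have /andP[+ _] := allP ab b (sub b (mem_head _ _)).
by case: b {sub} => //= *; rewrite size_cat.
Qed.

Lemma size_blocks s bs u :
  no_short_zero_sum s -> perm_eq (flatten bs ++ u) s -> all block bs ->
  (size (flatten bs) <= 2 * n)%N -> (size bs < n)%N.
Proof.
move=> ns ps ab sz; rewrite -cardK -(size_map (fun b => \sum_(x <- b) x)).
apply: size_zero_sum_free (blocks_zero_sum_free ns ps ab sz) (block_sums_in ab) => //.
Qed.

(** The two blocks may overlap, since each only has to be disjoint from [bs]. Exchanging them in a
    family of n - 1 blocks, the largest possible number, cannot change the sum. *)
Lemma block_exchange s bs b b' u u' :
  no_short_zero_sum s -> perm_eq (b ++ flatten bs ++ u) s ->
  perm_eq (b' ++ flatten bs ++ u') s -> all block [:: b, b' & bs] ->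
  (n <= (size bs).+2)%N ->
  (size (flatten bs) + maxn (size b) (size b') <= 2 * n)%N ->
  \sum_(x <- b) x = \sum_(x <- b') x.
Proof.
move=> ns pb pb' ab sz szf.
have /and3P[blb blb' abs] := ab.
apply: (@zero_sum_free_exchange G K K0 KD KN _ _ [seq \sum_(x <- c) x | c <- bs]) => //.
- apply: (@blocks_zero_sum_free s (b :: bs) u) => //=; rewrite -?catA ?blb // size_cat; lia.
- apply: (@blocks_zero_sum_free s (b' :: bs) u') => //=; rewrite -?catA ?blb' // size_cat; lia.
- exact: (block_sums_in ab).
- by rewrite cardK size_map.
Qed.

Definition nonzero_twins (p : G * G) := (cl p.1 == cl p.2) && (cl p.1 != 0).

Lemma block_pairs ps : all nonzero_twins ps -> all block (map (@pair_seq _) ps).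
Proof.
rewrite all_map; apply: sub_all => p /andP[/eqP e _]; apply/andP; split=> //=.
by rewrite /pair_seq !big_cons big_nil addr0 raddfD e addVV.
Qed.

(** Terms are added one at a time: a term of class 0 goes to Z, a term whose class occurs in R is
    paired with the term there, and any other term joins R. *)
Lemma class_decomposition s : exists Z ps R,
  [/\ perm_eq s (Z ++ flatten (map (@pair_seq _) ps) ++ R),
      all (fun x => cl x == 0) Z, all nonzero_twins ps,
      uniq (map cl R) & 0 \notin map cl R].
Proof.
elim: s => [|x s [Z [ps [R [pe aZ aps uR R0]]]]].
  by exists [::], [::], [::].
have [x0|x0] := boolP (cl x == 0).
  by exists (x :: Z), ps, R; split=> //; rewrite /= ?x0 // perm_cons.
have [/mapP[y yR e]|xR] := boolP (cl x \in map cl R); last first.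
  exists Z, ps, (x :: R); split=> //; first by perm_count.
    by rewrite /= xR.
  by rewrite /= inE negb_or eq_sym x0.
have pR := perm_to_rem yR; have pcR := perm_map cl pR.
exists Z, ((x, y) :: ps), (rem y R); split=> //; first by perm_count.
- by rewrite /= /nonzero_twins x0 e eqxx.
- by move: uR; rewrite (perm_uniq pcR) /= => /andP[].
- by move: R0; rewrite (perm_mem pcR) inE negb_or => /andP[].
Qed.

(* Write the six classes as x, y, x + y, x + q, y + q, x + y + q. The four
   triples that are blocks cover every term twice, and so do the three
   quadruples. As all of them have the same sum e, 4e = 3e. *)
Lemma no_six_classes s ps R u : no_short_zero_sum s ->
  perm_eq (flatten (map (@pair_seq _) ps) ++ R ++ u) s -> all nonzero_twins ps ->
  size ps = n.-2 -> uniq (map cl R) -> 0 \notin map cl R -> size R = 6 -> False.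
Proof.
move=> ns pe aps sps uR R0 s6.
have [|x [y [q pR]]] := six_classes uR R0; first by rewrite size_map.
have [R' pRR' eR'] := perm_map_lift pR.
case: R' pRR' eR' => [|X [|Y [|Z [|X' [|Y' [|Z' []]]]]]] //= pRR' [eX eY eZ eX' eY' eZ'].
(* The n - 2 pairs leave room for a block of length up to 4, so any two such blocks inside R have
   the same sum. *)
have ex b b' v v' : perm_eq (b ++ v) R -> perm_eq (b' ++ v') R ->
    block b -> block b' -> (size b <= 4)%N -> (size b' <= 4)%N ->
    \sum_(x <- b) x = \sum_(x <- b') x.
  move=> pb pb' bb bb' sb sb'.
  apply: (@block_exchange s (map (@pair_seq _) ps) _ _ (v ++ u) (v' ++ u)) => //.
  - by perm_count.
  - by perm_count.
  - by rewrite /= bb bb' block_pairs.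
  - by rewrite size_map sps; clear -n_gt1; lia.
  - by rewrite size_flatten_pairs sps; clear -n_gt1 sb sb'; lia.
have blk b : b != [::] -> \sum_(c <- map cl b) c = 0 -> block b.
  by rewrite big_map => nb e; rewrite /block nb raddf_sum e eqxx.
have [h1 h2 h3 [h4 h5 h6 h7]] := six_class_sums x y q.
have b0 : block [:: X; Y; Z].
  by apply: blk; rewrite //= eX eY eZ !big_cons big_nil h1.
have b1 : block [:: X; Y'; Z'].
  by apply: blk; rewrite //= eX eY' eZ' !big_cons big_nil h2.
have b2 : block [:: X'; Y; Z'].
  by apply: blk; rewrite //= eX' eY eZ' !big_cons big_nil h3.
have b3 : block [:: X'; Y'; Z].
  by apply: blk; rewrite //= eX' eY' eZ !big_cons big_nil h4.
have c1 : block [:: X; X'; Y; Y'].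
  by apply: blk; rewrite //= eX eX' eY eY' !big_cons big_nil h5.
have c2 : block [:: X; X'; Z; Z'].
  by apply: blk; rewrite //= eX eX' eZ eZ' !big_cons big_nil h6.
have c3 : block [:: Y; Y'; Z; Z'].
  by apply: blk; rewrite //= eY eY' eZ eZ' !big_cons big_nil h7.
set e := \sum_(x <- [:: X; Y; Z]) x.
have p0 : perm_eq ([:: X; Y; Z] ++ [:: X'; Y'; Z']) R by perm_count.
have s1 : \sum_(x <- [:: X; Y'; Z']) x = e.
  by apply: (ex _ _ [:: X'; Y; Z] [:: X'; Y'; Z']) => //; perm_count.
have s2 : \sum_(x <- [:: X'; Y; Z']) x = e.
  by apply: (ex _ _ [:: X; Y'; Z] [:: X'; Y'; Z']) => //; perm_count.
have s3 : \sum_(x <- [:: X'; Y'; Z]) x = e.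
  by apply: (ex _ _ [:: X; Y; Z'] [:: X'; Y'; Z']) => //; perm_count.
have t1 : \sum_(x <- [:: X; X'; Y; Y']) x = e.
  by apply: (ex _ _ [:: Z; Z'] [:: X'; Y'; Z']) => //; perm_count.
have t2 : \sum_(x <- [:: X; X'; Z; Z']) x = e.
  by apply: (ex _ _ [:: Y; Y'] [:: X'; Y'; Z']) => //; perm_count.
have t3 : \sum_(x <- [:: Y; Y'; Z; Z']) x = e.
  by apply: (ex _ _ [:: X; X'] [:: X'; Y'; Z']) => //; perm_count.
have /eqP : e + (e + (e + e)) = e + (e + e).
  have : \sum_(x <- [:: X; Y; Z] ++ [:: X; Y'; Z'] ++ [:: X'; Y; Z'] ++ [:: X'; Y'; Z]) x
    = \sum_(x <- [:: X; X'; Y; Y'] ++ [:: X; X'; Z; Z'] ++ [:: Y; Y'; Z; Z']) x.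
    by apply: perm_big; perm_count.
  by rewrite ![\sum_(_ <- _ ++ _) _]big_cat s1 s2 s3 t1 t2 t3.
rewrite -subr_eq0 addrK.
(* Now e = 0, although e is the sum of a block of length 3. *)
have : zero_sum_free [seq \sum_(x <- b) x | b <- [:: X; Y; Z] :: map (@pair_seq _) ps].
  apply: (@blocks_zero_sum_free s _ ([:: X'; Y'; Z'] ++ u)) => //.
  - by perm_count.
  - by rewrite /= b0 block_pairs.
  - by rewrite /= size_flatten_pairs sps; clear -n_gt1; lia.
move=> /(_ [:: e]); rewrite /= eqxx sub0seq big_seq1 => /(_ isT isT).
by move/negPf->.
Qed.

End Blocks.

(* Linear independence over the field with two elements. *)
Definition free3 (a b c : V) :=
  [&& a != 0, b != 0, c != 0, a + b != 0, a + c != 0, b + c != 0 & a + b + c != 0].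

(** Independence survives adding r to u or v, so either term of each of the two pairs of classes
    summing to r may later serve as g or h. *)
Lemma five_classes_free3 (r u v : V) :
  uniq [:: r; u; u + r; v; v + r] -> 0 \notin [:: r; u; u + r; v; v + r] ->
  [&& free3 r u v, free3 r (u + r) v, free3 r u (v + r) & free3 r (u + r) (v + r)].
Proof. by move: r u v => [[[] []] []] [[[] []] []] [[[] []] []]. Qed.

Lemma perm_nseq3 (T : eqType) (a b c : T) (q : seq T) :
  uniq [:: a; b; c] -> {subset q <= [:: a; b; c]} ->
  perm_eq q (nseq (count_mem a q) a ++ nseq (count_mem b q) b ++ nseq (count_mem c q) c).
Proof.
rewrite /= !inE negb_or -andbA => /and4P[ab ac bc _].
elim: q => // x q IH sub.
have {}IH : perm_eq q
    (nseq (count_mem a q) a ++ nseq (count_mem b q) b ++ nseq (count_mem c q) c).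
  by apply: IH => y yq; apply: sub; rewrite inE yq orbT.
have := sub x (mem_head _ _); rewrite !inE => /or3P[] /eqP->.
- rewrite /= eqxx (negPf ab) (negPf ac); perm_count.
- rewrite /= eqxx eq_sym (negPf ab) (negPf bc); perm_count.
- rewrite /= eqxx eq_sym (negPf ac) eq_sym (negPf bc); perm_count.
Qed.

(** * Decomposition into n - 1 pairs and five single terms *)

Section PairDecomposition.
Variables (n : nat) (G : finZmodType) (cl : {additive G -> V}).
Let K : {set G} := [set g | cl g == 0].
Hypotheses (n_gt1 : (1 < n)%N) (cardK : #|K| = n).
Implicit Types (s t u b : seq G) (bs : seq (seq G)) (ps : seq (G * G)).

Lemma size_flatten_le2 bs : all (fun b => size b <= 2)%N bs ->
  (size (flatten bs) <= 2 * size bs)%N.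
Proof. by elim: bs => //= b bs IH /andP[sb /IH]; rewrite size_cat; clear -sb; lia. Qed.

Lemma size_flatten_take bs k : all (fun b => size b <= 2)%N bs ->
  (size (flatten (take k bs)) <= 2 * k)%N.
Proof.
rewrite -{1}(cat_take_drop k bs) all_cat => /andP[/size_flatten_le2 h _].
by apply: (leq_trans h); rewrite leq_mul2l size_take_min geq_minl.
Qed.

Lemma flatten_take_drop bs k :
  flatten bs = flatten (take k bs) ++ flatten (drop k bs).
Proof. by rewrite -flatten_cat cat_take_drop. Qed.

Lemma nonzero_triple R : uniq (map cl R) -> 0 \notin map cl R -> (6 <= size R)%N ->
  exists b R', [/\ perm_eq R (b ++ R'), block cl b & size b = 3].
Proof.
move=> uR R0 sR; rewrite -(cat_take_drop 6 R) in uR R0 *.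
have s6 : size (map cl (take 6 R)) = 6 by rewrite size_map size_takel.
move: uR R0; rewrite map_cat cat_uniq mem_cat negb_or => /and3P[uR _ _] /andP[R0 _].
have [x [y [q pR]]] := six_classes uR R0 s6.
have [R' pRR' eR'] := perm_map_lift pR.
case: R' pRR' eR' => [|X [|Y [|Z R']]] //= pRR' [eX eY eZ _].
exists [:: X; Y; Z], (R' ++ drop 6 R); split=> //; first by perm_count.
by rewrite /block /= raddf_sum !big_cons big_nil eX eY eZ addr0 addrA addVV.
Qed.

(* A term in K is a block of length 1, so a sequence with such a term has n
   disjoint blocks of total length at most 2n. *)
Lemma decomposition_no_zero s Z ps R :
  no_short_zero_sum n s -> (2 * n + 3 <= size s)%N ->
  perm_eq s (Z ++ flatten (map (@pair_seq _) ps) ++ R) ->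
  all (fun x => cl x == 0) Z -> all (nonzero_twins cl) ps ->
  uniq (map cl R) -> 0 \notin map cl R -> Z = [::].
Proof.
case: Z => // z Z ns ss pe /= /andP[z0 Z0] aps uR R0; exfalso.
pose bs := map (fun x => [:: x]) Z ++ map (@pair_seq _) ps.
have fbs : flatten bs = Z ++ flatten (map (@pair_seq _) ps).
  by rewrite flatten_cat flatten_seq1.
have blbs : all (block cl) bs.
  rewrite all_cat block_pairs // andbT all_map; apply: sub_all Z0 => x x0 /=.
  by rewrite /block big_seq1 x0.
have s2 : all (fun b => size b <= 2)%N bs.
  by rewrite all_cat !all_map /= !all_predT.
have sbs : size bs = (size Z + size ps)%N by rewrite size_cat !size_map.
have bz : block cl [:: z] by rewrite /block big_seq1 z0.
have szs := perm_size pe; rewrite /= !size_cat size_flatten_pairs in szs.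
rewrite /= catA -fbs in pe.
have sR : (size R <= 7)%N.
  by rewrite -(size_map cl); apply: size_uniq_nonzero.
have bt k : all (block cl) (take k bs).
  by move: blbs; rewrite -{1}(cat_take_drop k bs) all_cat => /andP[].
(* If R has at most five terms, z and n - 1 blocks of length at most 2 are n blocks of total length
   at most 2n - 1. *)
have [R5|R6] := leqP (size R) 5.
  have sf := size_flatten_take n.-1 s2.
  have : (size ([:: z] :: take n.-1 bs) < n)%N.
    apply: (@size_blocks n G cl cardK s _ (flatten (drop n.-1 bs) ++ R) ns).
    - rewrite perm_sym; apply: (perm_trans pe).
      by rewrite (flatten_take_drop _ n.-1); perm_count.
    - by rewrite /= bz bt.
    - by rewrite /=; clear -sf n_gt1; lia.
  rewrite /= size_takel; first by clear -n_gt1; lia.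
  by rewrite sbs; clear -szs ss R5; lia.
(* Otherwise a triple from R, z and n - 2 blocks of length at most 2 are n blocks of total length at
   most 3 + 1 + 2(n - 2) = 2n. *)
have [b [R' [pR blb sb]]] := nonzero_triple uR R0 R6.
have sf := size_flatten_take n.-2 s2.
have : (size (b :: [:: z] :: take n.-2 bs) < n)%N.
  apply: (@size_blocks n G cl cardK s _ (flatten (drop n.-2 bs) ++ R') ns).
  - rewrite perm_sym; apply: (perm_trans pe).
    by rewrite (flatten_take_drop _ n.-2); perm_count.
  - by rewrite /= bz blb bt.
  - by rewrite /= size_cat /= sb; clear -sf n_gt1; lia.
rewrite /= size_takel; first by clear -n_gt1; lia.
by rewrite sbs; clear -szs ss sR; lia.
Qed.

(** There are at most n - 1 pairs by the bound on blocks, and at most five terms in R by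
    [no_six_classes]; a length of at least 2n + 3 forces equality in both. *)
Lemma pairs_decomposition s : no_short_zero_sum n s -> (2 * n + 3 <= size s)%N ->
  exists ps R, [/\ perm_eq s (flatten (map (@pair_seq _) ps) ++ R),
    all (nonzero_twins cl) ps, uniq (map cl R), 0 \notin map cl R &
    size ps = n.-1 /\ size R = 5].
Proof.
move=> ns ss; have [Z [ps [R [pe Z0 aps uR R0]]]] := class_decomposition cl s.
have Z_nil := decomposition_no_zero ns ss pe Z0 aps uR R0.
rewrite {}Z_nil /= in pe; exists ps, R; split=> //.
have szs := perm_size pe; rewrite /= size_cat size_flatten_pairs in szs.
have sR : (size R <= 7)%N.
  by rewrite -(size_map cl); apply: size_uniq_nonzero.
have tp k : all (nonzero_twins cl) (take k ps).
  by move: aps; rewrite -{1}(cat_take_drop k ps) all_cat => /andP[].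
have R5 : (size R <= 5)%N.
  rewrite leqNgt; apply/negP => R6.
  apply: (@no_six_classes n G cl n_gt1 cardK s (take n.-2 ps) (take 6 R)
     (flatten (map (@pair_seq _) (drop n.-2 ps)) ++ drop 6 R)) => //.
  - rewrite perm_sym; apply: (perm_trans pe).
    rewrite -{1}(cat_take_drop n.-2 ps) -{1}(cat_take_drop 6 R).
    by perm_count.
  - by rewrite size_takel //; clear -szs ss sR; lia.
  - by rewrite map_take take_uniq.
  - by apply: contra R0; rewrite map_take; apply: mem_take.
  - by rewrite size_takel.
have psn : (size ps < n)%N.
  rewrite ltnNge; apply/negP => nps.
  have : (size (map (@pair_seq _) (take n ps)) < n)%N.
    apply: (@size_blocks n G cl cardK s _
      (flatten (map (@pair_seq _) (drop n ps)) ++ R) ns).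
    - rewrite perm_sym; apply: (perm_trans pe).
      by rewrite -{1}(cat_take_drop n ps); perm_count.
    - exact: block_pairs.
    - by rewrite size_flatten_pairs size_takel.
  by rewrite size_map size_takel // ltnn.
by clear -szs ss R5 psn; split; lia.
Qed.

(** The decomposition accounts for exactly 2(n - 1) + 5 terms, whence the upper bound for eta. *)
Lemma size_no_short s : no_short_zero_sum n s -> (size s < 2 * n + 4)%N.
Proof.
move=> ns; have [//|ss] := ltnP (size s) (2 * n + 4).
have [|ps [R [/perm_size + _ _ _ [sp sR]]]] := pairs_decomposition ns.
  by clear -ss; lia.
by rewrite size_cat size_flatten_pairs sp sR => e; rewrite e in ss; clear -n_gt1 ss; lia.
Qed.

End PairDecomposition.

(** * The normal form *)

Lemma flatten_diagonal_pairs (T : eqType) (ps : seq (T * T)) :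
  {in ps, forall p, p.1 = p.2} ->
  perm_eq (flatten (map (@pair_seq _) ps)) (map fst ps ++ map fst ps).
Proof.
elim: ps => // [[x y] ps IH] e.
have {}IH : perm_eq (flatten (map (@pair_seq _) ps)) (map fst ps ++ map fst ps).
  by apply: IH => p pin; apply: e; rewrite inE pin orbT.
by have /= <- := e (x, y) (mem_head _ _); perm_count.
Qed.

Lemma five_class_sums (r u v : V) :
  r + (u + (u + r + 0)) = 0 /\ u + (u + r + (v + (v + r + 0))) = 0.
Proof. by move: r u v => [[[] []] []] [[[] []] []] [[[] []] []]; split. Qed.

Section NormalForm.
Variables (n : nat) (G : finZmodType) (cl : {additive G -> V}).
Let K : {set G} := [set g | cl g == 0].
Hypotheses (n_gt1 : (1 < n)%N) (cardK : #|K| = n).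
Hypothesis (exp2n : forall g : G, g *+ (2 * n) = 0).
Implicit Types (s : seq G) (f g h : G) (ps : seq (G * G)).

(* The last clause says that n divides the order of 2f. *)
Definition normal_form s f g h a b c :=
  [/\ perm_eq s (nseq (2 * a + 1) f ++ nseq (2 * b + 1) g
                 ++ nseq (2 * c + 1) h ++ [:: f - g; f - h]),
      (a + b + c = n - 1)%N,
      (b = 0%N \/ g + g = f + f) /\ (c = 0%N \/ h + h = f + f),
      free3 (cl f) (cl g) (cl h) &
      forall j, (f + f) *+ j = 0 -> (n %| j)%N].

(** The list q holds the common value of the two terms of each pair. *)
Lemma twins_structure s : no_short_zero_sum n s -> (2 * n + 3 <= size s)%N ->
  exists f g g' h h' q,
  [/\ perm_eq s (q ++ q ++ [:: f; g; g'; h; h']),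
      {subset q <= [:: f; g; g'; h; h']} /\ size q = n.-1,
      {in q, forall x, x + x = f + f},
      [/\ g + g' = f, h + h' = f & forall j, (0 < j < n)%N -> (f + f) *+ j != 0] &
      [&& free3 (cl f) (cl g) (cl h), free3 (cl f) (cl g') (cl h),
          free3 (cl f) (cl g) (cl h') & free3 (cl f) (cl g') (cl h')]].
Proof.
move=> ns ss; have [ps [R [pe aps uR R0 [sps sR]]]] := pairs_decomposition n_gt1 cardK ns ss.
have [|r [u [v pR]]] := five_classes uR R0; first by rewrite size_map.
rewrite (perm_uniq pR) in uR; rewrite (perm_mem pR) in R0.
have fr := five_classes_free3 uR R0.
have [R' pRR' eR'] := perm_map_lift pR.
have {pe}pe : perm_eq (flatten (map (@pair_seq _) ps) ++ R') s.
  by rewrite perm_sym (permPl pe) perm_cat2l.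
case: R' pRR' eR' pe => [|f [|g [|g' [|h [|h' []]]]]] //= pRR' [ef eg eg' eh eh'] pe.
pose R' := [:: f; g; g'; h; h'].
rewrite -/R' in pe.
have eR' : map cl R' = [:: r; u; u + r; v; v + r] by rewrite /= ef eg eg' eh eh'.
have blf (b : seq G) : b != [::] -> \sum_(c <- map cl b) c = 0 -> block cl b.
  by move=> nb e; rewrite /block nb raddf_sum -(big_map cl xpredT id) e eqxx.
have b1 : block cl [:: f; g; g'].
  apply: blf => //; rewrite /= !big_cons big_nil ef eg eg'.
  exact: (five_class_sums r u v).1.
have b2 : block cl [:: f; h; h'].
  apply: blf => //; rewrite /= !big_cons big_nil ef eh eh'.
  exact: (five_class_sums r v u).1.
have b3 : block cl [:: g; g'; h; h'].
  apply: blf => //; rewrite /= !big_cons big_nil eg eg' eh eh'.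
  exact: (five_class_sums r u v).2.
have rems (p : G * G) : p \in ps -> perm_eq (flatten (map (@pair_seq _) ps))
     (pair_seq p ++ flatten (map (@pair_seq _) (rem p ps))).
  by move=> /perm_to_rem pp; rewrite -[X in perm_eq _ X]/(flatten (map _ (p :: rem p ps)));
    apply: perm_flatten; apply: perm_map.
have srem (p : G * G) : p \in ps -> size (rem p ps) = n.-2.
  by move=> pin; rewrite size_rem // sps.
have arem (p : G * G) : all (nonzero_twins cl) (rem p ps).
  by apply/allP => x /mem_rem/(allP aps).
(* With the n - 2 pairs other than p kept fixed, all blocks of length at most 4 among p and R' have
   the same sum. *)
have ex (p : G * G) (b b' v1 v2 : seq G) : p \in ps -> perm_eq (b ++ v1) (pair_seq p ++ R') ->
    perm_eq (b' ++ v2) (pair_seq p ++ R') -> block cl b -> block cl b' ->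
    (size b <= 4)%N -> (size b' <= 4)%N -> \sum_(x <- b) x = \sum_(x <- b') x.
  move=> pin pb pb' bb bb' sb sb'; have pp := rems p pin.
  apply: (@block_exchange n G cl n_gt1 cardK s (map (@pair_seq _) (rem p ps)) _ _ v1 v2) => //.
  - by perm_count.
  - by perm_count.
  - by rewrite /= bb bb' block_pairs.
  - by rewrite size_map srem //; clear -n_gt1; lia.
  - by rewrite size_flatten_pairs srem //; clear -n_gt1 sb sb'; lia.
set e := \sum_(x <- [:: f; g; g']) x.
have [p0 p0in] : exists p0, p0 \in ps.
  have : (0 < size ps)%N by rewrite sps; clear -n_gt1; lia.
  by case: (ps) => // p0 ps' _; exists p0; rewrite mem_head.
have bp (p : G * G) : p \in ps -> block cl (pair_seq p).
  move=> pin; have : all (nonzero_twins cl) [:: p] by rewrite /= (allP aps _ pin).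
  by move/block_pairs => /= /andP[].
have e2 : \sum_(x <- [:: f; h; h']) x = e.
  by apply: (ex p0 _ _ (pair_seq p0 ++ [:: g; g']) (pair_seq p0 ++ [:: h; h'])) => //;
    rewrite /R'; perm_count.
have e3 : \sum_(x <- [:: g; g'; h; h']) x = e.
  by apply: (ex p0 _ _ (pair_seq p0 ++ [:: f]) (pair_seq p0 ++ [:: h; h'])) => //;
    rewrite /R'; perm_count.
have ep (p : G * G) : p \in ps -> p.1 + p.2 = e.
  move=> pin; have <- : \sum_(x <- pair_seq p) x = p.1 + p.2.
    by rewrite !big_cons big_nil addr0.
  by apply: (ex p _ _ R' (pair_seq p ++ [:: h; h'])) => //; rewrite ?bp // /R'; perm_count.
have sff : \sum_(x <- [:: f; f]) x = f + f by rewrite !big_cons big_nil addr0.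
(* The two triples together are the quadruple and two copies of f, so 2e = 2f + e. *)
have ff : f + f = e.
  have : \sum_(x <- [:: f; g; g'] ++ [:: f; h; h']) x =
         \sum_(x <- [:: f; f] ++ [:: g; g'; h; h']) x.
    by apply: perm_big; perm_count.
  rewrite ![\sum_(_ <- _ ++ _) _]big_cat e2 e3 -/e => /addIr E; rewrite -sff; exact: esym E.
have gg : g + g' = f.
  by apply: (addrI f); rewrite ff /e !big_cons big_nil addr0.
have hh : h + h' = f.
  by apply: (addrI f); rewrite ff -e2 !big_cons big_nil addr0.
have diag (p : G * G) : p \in ps -> p.1 = p.2 /\ p.1 \in R'.
  move=> pin; have /andP[/eqP e12 n1] := allP aps _ pin; have pp := rems p pin.
  (* If the class of p.1 were missing from R', adding p.1 would give six classes alongside n - 2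
     pairs. *)
  have [|cR] := boolP (cl p.1 \in map cl R'); last first.
    exfalso; apply: (@no_six_classes n G cl n_gt1 cardK s (rem p ps) (p.1 :: R') [:: p.2]) => //.
    - by perm_count.
    - exact: srem.
    - by rewrite map_cons cons_uniq cR eR'.
    - by rewrite map_cons inE negb_or eq_sym n1 eR'.
  (* With x in R' of the same class, p.1 + x, p.2 + x and p.1 + p.2 all equal e, so p.1 = p.2 =
     x. *)
  move=> /mapP[x xR ex1]; have pRx := perm_to_rem xR.
  have s1 : p.1 + x = e.
    have <- : \sum_(y <- [:: p.1; x]) y = p.1 + x.
      by rewrite !big_cons big_nil addr0.
    apply: (ex p _ _ (p.2 :: rem x R') (pair_seq p ++ [:: h; h'])) => //.
    - by perm_count.
    - by rewrite /R'; perm_count.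
    - by apply: blf => //; rewrite /= !big_cons big_nil addr0 -ex1 addVV.
  have s2 : p.2 + x = e.
    have <- : \sum_(y <- [:: p.2; x]) y = p.2 + x.
      by rewrite !big_cons big_nil addr0.
    apply: (ex p _ _ (p.1 :: rem x R') (pair_seq p ++ [:: h; h'])) => //.
    - by perm_count.
    - by rewrite /R'; perm_count.
    - by apply: blf => //; rewrite /= !big_cons big_nil addr0 -ex1 -e12 addVV.
  have p12 : p.1 = p.2 by apply: (addIr x); rewrite s1 s2.
  split=> //; have : p.1 = x by apply: (addrI p.1); rewrite s1 -(ep p pin) -p12.
  by move->.
exists f, g, g', h, h', (map fst ps); split.
- have pd := flatten_diagonal_pairs (fun p pin => (diag p pin).1).
  rewrite -/R'; perm_count.
- by rewrite size_map; split=> // _ /mapP[p pin ->]; apply: (diag p pin).2.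
- move=> _ /mapP[p pin ->]; rewrite ff -(ep p pin).
  by rewrite {2}(diag p pin).1.
- split=> // j jn; rewrite ff.
  (* The n - 1 pair sums, all equal to e = 2f, form a zero-sum free sequence, so je is nonzero for 0
     < j < n. *)
  have zf := @blocks_zero_sum_free n G cl s (map (@pair_seq _) ps) R' ns pe (block_pairs aps).
  have : zero_sum_free (nseq n.-1 e).
    suff <- : [seq \sum_(x <- b) x | b <- map (@pair_seq _) ps] = nseq n.-1 e.
      by apply: zf; rewrite size_flatten_pairs sps; clear -n_gt1; lia.
    rewrite -sps; clear -ep; elim: ps ep => //= p ps IH ep.
    rewrite IH; last by move=> p' pin; apply: ep; rewrite inE pin orbT.
    by rewrite !big_cons big_nil addr0 ep ?mem_head.
  move=> /(_ (nseq j e)); rewrite big_nseq -Monoid.iteropE; apply.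
    rewrite (_ : n.-1 = (j + (n.-1 - j))%N); last by clear -jn; lia.
    by rewrite nseqD prefix_subseq.
  by clear -jn; case: j jn.
- by rewrite ef eg eg' eh eh'.
Qed.

(** If g and g' both occurred in q, then 4f = 2g + 2g' = 2f, against 2f being nonzero; likewise for
    h and h'. So, after renaming, q contains only f, g and h, and a, b, c are their
    multiplicities. *)
Lemma normal_form_exists s : no_short_zero_sum n s -> (2 * n + 3 <= size s)%N ->
  exists f g h a b c, normal_form s f g h a b c.
Proof.
move=> ns ss; have [f [g [g' [h [h' [q [pe [sq szq] eq [gg hh ord] fr]]]]]]] :=
  twins_structure ns ss.
have dvd j : (f + f) *+ j = 0 -> (n %| j)%N.
  rewrite {1}(divn_eq j n) mulrnDr mulnC mulrnA.
  have -> : (f + f) *+ n = 0 by rewrite -mulr2n -mulrnA exp2n.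
  rewrite mul0rn add0r => j0; rewrite /dvdn; case: posnP => // jn.
  have := ord (j %% n)%N; rewrite jn ltn_pmod ?j0 ?eqxx; first by move/(_ isT).
  by clear -n_gt1; lia.
have ff : f + f != 0 by have := ord 1%N; rewrite mulr1n; apply; rewrite n_gt1.
have one (x y : G) : x + y = f -> x \in q -> y \notin q.
  move=> xy xq; apply/negP => yq; case/eqP: ff.
  have E : (f + f) + (f + f) = f + f by rewrite -{1}(eq x xq) -{1}(eq y yq) addrACA xy.
  by apply: (addrI (f + f)); rewrite E addr0.
have [x [x' [xx nx' frx]]] : exists x x', [/\ x + x' = f /\ perm_eq [:: g; g'] [:: x; x'],
    x' \notin q & free3 (cl f) (cl x) (cl h) && free3 (cl f) (cl x) (cl h')].
  case/and4P: fr => f1 f2 f3 f4; have [g'q|g'q] := boolP (g' \in q).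
    exists g', g; rewrite f2 f4 addrC gg (one g') ?(addrC g') //.
    by split=> //; split=> //; perm_count.
  by exists g, g'; rewrite f1 f3.
have [y [y' [yy ny' fry]]] : exists y y', [/\ y + y' = f /\ perm_eq [:: h; h'] [:: y; y'],
    y' \notin q & free3 (cl f) (cl x) (cl y)].
  case/andP: frx => f1 f2; have [h'q|h'q] := boolP (h' \in q).
    exists h', h; rewrite f2 addrC hh (one h') ?(addrC h') //.
    by split=> //; split=> //; perm_count.
  by exists h, h'; rewrite f1.
case: xx => xx pgx; case: yy => yy phy.
have uq : uniq [:: f; x; y].
  have : uniq (map cl [:: f; x; y]) by move: fry; rewrite /free3 /=;
    move: (cl f) (cl x) (cl y) => [[[] []] []] [[[] []] []] [[[] []] []].
  exact: map_uniq.
have pq := @perm_nseq3 _ f x y q uq.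
exists f, x, y, (count_mem f q), (count_mem x q), (count_mem y q).
have sub : {subset q <= [:: f; x; y]}.
  move=> z zq; have := sq z zq.
  have nx : z != x' by apply: contraNneq nx' => <-.
  have ny : z != y' by apply: contraNneq ny' => <-.
  have := perm_mem pgx z; have := perm_mem phy z.
  rewrite !inE (negPf nx) (negPf ny) !orbF => <- <-.
  by rewrite !orbA.
have {}pq := pq sub.
split=> //.
- rewrite (_ : f - x = x'); last by rewrite -xx addrC addrA addNr add0r.
  rewrite (_ : f - y = y'); last by rewrite -yy addrC addrA addNr add0r.
  rewrite !mul2n -!addnn !nseqD; perm_count.
- by rewrite subn1 -szq (perm_size pq) !size_cat !size_nseq addnA.
- split.
    have [xq|/count_memPn ->] := boolP (x \in q); [by right; apply: eq | by left].
  have [yq|/count_memPn ->] := boolP (y \in q); [by right; apply: eq | by left].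
Qed.

End NormalForm.

(** * Independence in G / 2G *)

Lemma mulVn (c : V) k : c *+ k = c *+ odd k.
Proof.
by rewrite -{1}(odd_double_half k) mulrnDr -mul2n mulrnA mulr2n addVV mul0rn addr0.
Qed.

Lemma oppV (c : V) : - c = c.
Proof. by apply/eqP; rewrite -subr_eq0 -opprD addVV oppr0. Qed.

Lemma free3P (a b c : V) : reflect
  (forall i j k : nat, a *+ i + b *+ j + c *+ k = 0 -> [&& ~~ odd i, ~~ odd j & ~~ odd k])
  (free3 a b c).
Proof.
apply: (iffP idP) => [fr i j k|fr].
  rewrite (mulVn a) (mulVn b) (mulVn c); move: fr.
  case: (odd i) (odd j) (odd k) => [] [] [] //=; rewrite /free3 ?mulr1n ?mulr0n ?add0r ?addr0;
    by move=> + /eqP e; rewrite e /= ?andbF.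
have nz i j k : odd i || odd j || odd k -> a *+ i + b *+ j + c *+ k != 0.
  by move=> o; apply/eqP => /fr; move: o; case: (odd i) (odd j) (odd k) => [] [] [].
have := (nz 1 0 0, nz 0 1 0, nz 0 0 1, nz 1 1 0, nz 1 0 1, nz 0 1 1, nz 1 1 1)%N.
rewrite !mulr1n !mulr0n !add0r !addr0 => -[[[[[[h1 h2] h3] h4] h5] h6] h7].
by rewrite /free3 h1 ?h2 ?h3 ?h4 ?h5 ?h6 ?h7.
Qed.

Lemma free3_comb (a b c : V) i j :
  free3 a b c -> free3 (c + a *+ i) (b + a *+ j) a.
Proof.
move=> /free3P fr; apply/free3P => x y z e.
have /and3P[ez ey ex] : [&& ~~ odd (i * x + j * y + z), ~~ odd y & ~~ odd x].
  apply: fr; rewrite -e !mulrnDl !mulrnDr -!mulrnA !addrA.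
  by rewrite [LHS](ACl (5*1*4*2*3)).
by move: ez; rewrite ex ey !oddD !oddM (negPf ex) (negPf ey) !andbF => ->.
Qed.

Lemma free3_swap23 (a b c : V) : free3 a b c -> free3 a c b.
Proof.
move=> /free3P fr; apply/free3P => x y z; rewrite addrAC => /fr.
by case/and3P=> -> -> ->.
Qed.

Lemma free3_swap12 (a b c : V) : free3 a b c -> free3 b a c.
Proof.
move=> /free3P fr; apply/free3P => x y z; rewrite (addrC (b *+ x)) => /fr.
by case/and3P=> -> -> ->.
Qed.

Lemma free3_generate (a b c d : V) : free3 a b c ->
  exists i j k : nat, d = a *+ i + b *+ j + c *+ k.
Proof.
have : all (fun a => all (fun b => all (fun c => free3 a b c ==> all (fun d =>
    has (fun m : V => d == a *+ m.1.1 + b *+ m.1.2 + c *+ m.2) allV) allV) allV) allV) allV.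
  by vm_compute.
move=> /allP/(_ a (memV a))/allP/(_ b (memV b))/allP/(_ c (memV c))/implyP h /h.
by move=> /allP/(_ d (memV d))/hasP[m _ /eqP->]; exists m.1.1, m.1.2, m.2.
Qed.

(** Applied once to each of the five terms of the normal form, this describes a subsequence by its
    multiplicities. *)
Lemma perm_cat_nseq (T : eqType) (t u s : seq T) m (x : T) :
  perm_eq (t ++ u) (nseq m x ++ s) ->
  exists k t' u', [/\ (k <= m)%N, perm_eq t (nseq k x ++ t') & perm_eq (t' ++ u') s].
Proof.
elim: m t u => [|m IH] t u /= ptu; first by exists 0%N, t, u.
have := mem_head x (nseq m x ++ s); rewrite -(perm_mem ptu) mem_cat => /orP[xt|xu].
  have pt := perm_to_rem xt.
  have [|k [t' [u' [km pt' pu']]]] := IH (rem x t) u.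
    by rewrite -(perm_cons x); perm_count.
  by exists k.+1, t', u'; split=> //; perm_count.
have pu := perm_to_rem xu.
have [|k [t' [u' [km pt' pu']]]] := IH t (rem x u).
  by rewrite -(perm_cons x); perm_count.
by exists k, t', u'; split=> //; exact: leqW.
Qed.

Lemma sum_nseq (M : zmodType) (m : nat) (x : M) : \sum_(y <- nseq m x) y = x *+ m.
Proof. by rewrite big_nseq -Monoid.iteropE. Qed.

(** * Sufficiency of the normal form *)

Section NormalFormNoShort.
Variables (n : nat) (G : finZmodType) (cl : {additive G -> V}).
Hypotheses (n_gt1 : (1 < n)%N).
Implicit Types (s : seq G) (f g h : G).

(** A zero-sum subsequence t takes i, j, k, l, m copies of f, g, h, f - g, f - h. Independence
    modulo 2G yields parity conditions, under which the sum is w times 2f with 2w = |t| - l - m;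
    hence n divides w. *)
Lemma normal_form_no_short s f g h a b c :
  normal_form n cl s f g h a b c -> no_short_zero_sum n s.
Proof.
move=> [ps abc [gb hc] /free3P fr dbl] t u ptu szt; apply/eqP => t0.
have {ps}ptu := perm_trans ptu ps.
have [i [t1 [u1 [ia pt1 ptu1]]]] := perm_cat_nseq ptu.
have [j [t2 [u2 [jb pt2 ptu2]]]] := perm_cat_nseq ptu1.
have [k [t3 [u3 [kc pt3 ptu3]]]] := perm_cat_nseq ptu2.
have [l [t4 [u4 [l1 pt4 ptu4]]]] := @perm_cat_nseq _ t3 u3 [:: f - h] 1 (f - g) ptu3.
have [m [t5 [u5 [m1 pt5 ptu5]]]] := @perm_cat_nseq _ t4 u4 [::] 1 (f - h) ptu4.
have t5_nil : t5 = [::].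
  by have := perm_size ptu5; rewrite size_cat; case: (t5).
rewrite {}t5_nil cats0 in pt5.
have pt : perm_eq t (nseq i f ++ (nseq l (f - g) ++ nseq j g) ++ (nseq m (f - h) ++ nseq k h)).
  by clear ptu ptu1 ptu2 ptu3 ptu4 ptu5; perm_count.
have szt' := perm_size pt; rewrite !size_cat !size_nseq in szt'.
move: t0; rewrite (perm_big _ pt) /= !big_cat /= !sum_nseq => t0.
have /and3P[oi oj ok] : [&& ~~ odd (i + l + m), ~~ odd (j + l) & ~~ odd (k + m)].
  apply: fr; rewrite -[RHS](raddf0 cl) -t0 ![in RHS]raddfD ![in RHS]raddfMn ![in RHS]raddfB.
  rewrite /= !oppV !mulrnDr.
  by rewrite !mulrnDl !addrA [RHS](ACl (1*2*5*4*3*7*6)).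
(* As p is at most 1 and has the parity of q, also p <= q. The p copies of f - x absorb p copies of
   x; the remaining copies come in pairs with 2x = 2f, and there are none when N = 0. *)
have fold_pair x p q N : (p <= 1)%N -> ~~ odd (q + p) -> (q <= 2 * N + 1)%N ->
    N = 0%N \/ x + x = f + f ->
    exists2 r, q = (p + 2 * r)%N & (f - x) *+ p + x *+ q = f *+ p + (f + f) *+ r.
  move=> p1 opq qN xN.
  have [r er] : exists r, q = (p + 2 * r)%N.
    by exists (q - p)./2; clear -p1 opq; lia.
  exists r => //; rewrite er mulrnDr mulrnBl addrA subrK; congr (_ + _).
  case: xN => [N0|e]; last by rewrite -e mulrnA mulr2n.
  have -> : r = 0%N by clear -qN N0 er; lia.
  by rewrite muln0.
have [j' ej gj] := fold_pair g l j b l1 oj jb gb.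
have [k' ek hk] := fold_pair h m k c m1 ok kc hc.
have ei : (i + l + m = 2 * (i + l + m)./2)%N by clear -oi; lia.
have : (f + f) *+ ((i + l + m)./2 + j' + k') = 0.
  have E : (f + f) *+ (i + l + m)./2 = f *+ (i + l + m) by rewrite {2}ei mulrnA mulr2n.
  rewrite -[RHS]t0 gj hk !mulrnDr E !mulrnDr !addrA.
  by rewrite [LHS](ACl (1*2*4*3*5)).
(* If d = 0, then t is empty. If d = 1, then |t| = 2n and l = m = 0, so i, j, k are even, hence at
   most 2a, 2b, 2c, and |t| <= 2n - 2. If d is larger, t is too long. *)
move=> /dbl/dvdnP[d ed].
rewrite szt' in szt; move: ed; case: d => [|[|d]] ed.
- by clear -ed ei ej ek szt; lia.
- by clear -ed ei ej ek szt ia jb kc l1 m1 abc oi oj ok n_gt1; lia.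
have : (2 * n <= d.+2 * n)%N by rewrite leq_mul2r orbT.
by clear -ed ei ej ek szt n_gt1; lia.
Qed.

End NormalFormNoShort.

(** * Bases *)

Lemma sum_triple (M : zmodType) (f1 f2 f3 : M) (a : 'I_3 -> int) :
  \sum_(i < 3) tnth [tuple f1; f2; f3] i *~ a i =
  f1 *~ a 0 + f2 *~ a 1 + f3 *~ a 2%:R.
Proof.
rewrite !big_ord_recl big_ord0 addr0 addrA !(tnth_nth 0) /=.
by do ![congr (_ + _)]; congr (_ *~ a _); apply: val_inj.
Qed.

Lemma ord3_cases (P : 'I_3 -> Prop) : P 0 -> P 1 -> P 2%:R -> forall i, P i.
Proof.
move=> P0 P1 P2 [[|[|[|//]]] lti].
- by rewrite (_ : Ordinal lti = 0) //; apply: val_inj.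
- by rewrite (_ : Ordinal lti = 1) //; apply: val_inj.
- by rewrite (_ : Ordinal lti = 2%:R) //; apply: val_inj.
Qed.

Lemma mulrz_even (M : zmodType) (x : M) (z : int) :
  x + x = 0 -> ~~ odd `|z|%N -> x *~ z = 0.
Proof.
move=> xx; have even k : ~~ odd k -> x *+ k = 0.
  move=> /negPf ok; rewrite -(odd_double_half k) ok add0n -mul2n mulrnA mulr2n xx.
  exact: mul0rn.
by case: z => k /even e; rewrite ?NegzE ?mulrNz -pmulrn ?e ?oppr0.
Qed.

Lemma mulVz (c : V) (z : int) : c *~ z = c *+ `|z|%N.
Proof. by case: z => k; rewrite ?NegzE ?mulrNz -pmulrn ?oppV ?abszN. Qed.

Lemma order_involution (G : finZmodType) (x : G) : x != 0 -> x + x = 0 -> #[x]%g = 2%N.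
Proof. by move=> x0 xx; apply: nt_prime_order => //; rewrite FinRing.zmodXgE mulr2n. Qed.

Lemma order_mulrz (G : finZmodType) (x : G) (z : int) :
  x *~ z = 0 -> (#[x]%g %| `|z|)%N.
Proof.
rewrite order_dvdn FinRing.zmodXgE => e; apply/eqP; rewrite FinRing.zmod1gE.
by case: z e => k //=; rewrite NegzE mulrNz -pmulrn => /eqP; rewrite oppr_eq0 => /eqP.
Qed.

Lemma odd_sub_double (i : nat) (z : int) : ~~ odd `|(i%:Z - z - z)%R|%N -> ~~ odd i.
Proof. lia. Qed.

Section Bases.
Variables (n : nat) (G : finZmodType) (cl : {additive G -> V}).
Let K : {set G} := [set g | cl g == 0].
Hypotheses (n_gt1 : (1 < n)%N) (cardK : #|K| = n).
Hypothesis (exp2n : forall g : G, g *+ (2 * n) = 0).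
Hypothesis (ker2 : forall g : G, cl g = 0 -> exists h, g = h + h).
Implicit Types (s : seq G) (f g h : G).

(** The multiples of 2f by 0, ..., n - 1 are n distinct elements of K, hence all of K. *)
Lemma kernel_multiple f x :
  (forall j, (f + f) *+ j = 0 -> (n %| j)%N) -> cl x = 0 ->
  exists j, x = (f + f) *+ j.
Proof.
move=> dbl x0; pose F (j : 'I_n) := (f + f) *+ j.
have Finj : injective F.
  suff H (i j : 'I_n) : (i <= j)%N -> F i = F j -> i = j.
    move=> i j; case: (leqP i j) => [|/ltnW] ij; first exact: H.
    by move=> /esym/(H _ _ ij).
  move=> ij /eqP; rewrite eq_sym -subr_eq0 /F -mulrnBr // => /eqP/dbl.
  move=> d; apply: val_inj => /=; have := ltn_ord j.
  by case: (posnP (j - i)) => [|/dvdn_leq/(_ d)]; lia.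
have sK : F @: setT \subset K.
  apply/subsetP => _ /imsetP[j _ ->].
  by rewrite inE raddfMn raddfD addVV mul0rn.
have : x \in F @: setT.
  have /eqP-> : F @: setT == K by rewrite eqEcard sK card_imset // cardsT card_ord cardK /=.
  by rewrite inE x0.
by move=> /imsetP[j _ ->]; exists j.
Qed.

(** An odd order would make the class of f vanish. So the order is even, and its half annihilates 2f
    and is a multiple of n. *)
Lemma order_double f : (forall j, (f + f) *+ j = 0 -> (n %| j)%N) -> cl f != 0 ->
  #[f]%g = (2 * n)%N.
Proof.
move=> dbl f0; have xf k : (f *+ k == 0) = (#[f]%g %| k)%N.
  by rewrite order_dvdn FinRing.zmodXgE FinRing.zmod1gE.
apply/eqP; rewrite eqn_dvd -xf exp2n eqxx /=.
have /eqP fo : f *+ #[f]%g == 0 by rewrite xf.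
have eo : ~~ odd #[f]%g.
  apply: contra f0 => o; have := raddf0 cl.
  by rewrite -fo raddfMn /= mulVn o => /eqP.
have eh : (#[f]%g = 2 * #[f]%g./2)%N by clear -eo; lia.
by rewrite eh dvdn_pmul2l //; apply: dbl; rewrite -mulr2n -mulrnA -eh.
Qed.

(** In a vanishing combination, independence modulo 2G makes the coefficients even, which kills the
    terms in f1 and f2. For generation, a combination of the right class is corrected by a multiple
    of 2f3. *)
Lemma free3_basis f1 f2 f3 :
  free3 (cl f1) (cl f2) (cl f3) -> f1 + f1 = 0 -> f2 + f2 = 0 ->
  (forall j, (f3 + f3) *+ j = 0 -> (n %| j)%N) ->
  is_basis [tuple f1; f2; f3] /\
  [/\ #[f1]%g = 2%N, #[f2]%g = 2%N & #[f3]%g = (2 * n)%N].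
Proof.
move=> fr t1 t2 dbl.
have nz x : cl x != 0 -> x != 0 by apply: contraNneq => ->; rewrite raddf0.
have /and4P[c1 c2 c3 _] := fr.
split; last by split; [apply: order_involution; rewrite ?nz..|apply: order_double].
split=> [a|g].
  rewrite sum_triple => e.
  have /and3P[o1 o2 _] : [&& ~~ odd `|a 0%R|%N, ~~ odd `|a 1%R|%N & ~~ odd `|a 2%:R|%N].
    move/free3P: fr; apply; rewrite -[RHS](raddf0 cl) -e ![in RHS]raddfD ![in RHS]raddfMz.
    by rewrite !mulVz.
  have e1 := mulrz_even t1 o1; have e2 := mulrz_even t2 o2.
  rewrite e1 e2 !add0r in e.
  by apply: ord3_cases; rewrite (tnth_nth 0).
have [i [j [k ek]]] := free3_generate (cl g) fr.
have [|m em] := @kernel_multiple f3 (g - (f1 *+ i + f2 *+ j + f3 *+ k)) dbl.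
  by rewrite raddfB ek -!(raddfMn cl) -!(raddfD cl) subrr.
exists (fun x : 'I_3 => if x == 0 then i%:Z else if x == 1 then j%:Z else (k + 2 * m)%:Z).
rewrite sum_triple /= -!pmulrn mulrnDr mulrnA mulr2n -em addrA [RHS]addrC.
by rewrite subrK.
Qed.

(** If a combination of the basis equals 2h, subtracting twice the coordinates of h leaves terms
    that all vanish; as the three orders are even, so are the original coefficients. *)
Lemma basis_free3 f1 f2 f3 :
  is_basis [tuple f1; f2; f3] ->
  #[f1]%g = 2%N -> #[f2]%g = 2%N -> #[f3]%g = (2 * n)%N ->
  [/\ free3 (cl f1) (cl f2) (cl f3), f1 + f1 = 0, f2 + f2 = 0 &
      forall j, (f3 + f3) *+ j = 0 -> (n %| j)%N].
Proof.
move=> [ind gen] o1 o2 o3.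
have xf x k : (x *+ k == 0 :> G) = (#[x]%g %| k)%N.
  by rewrite order_dvdn FinRing.zmodXgE FinRing.zmod1gE.
split.
- apply/free3P => i j k; rewrite -!raddfMn -!raddfD => /ker2[h].
  have [b ->] := gen h; rewrite sum_triple => e.
  pose a (x : 'I_3) : int := (if x == 0 then i%:Z else if x == 1 then j%:Z else k%:Z) - b x - b x.
  have a0 : forall x, tnth [tuple f1; f2; f3] x *~ a x = 0.
    apply: ind; rewrite sum_triple /a /= !mulrzBr -!pmulrn !addrA.
    by rewrite [LHS](ACl (1*4*7*((2*5*8)*(3*6*9)))) /= -!opprD e subrr.
  have ev x i' : odd #[tnth [tuple f1; f2; f3] x]%g = false ->
      a x = i'%:Z - b x - b x -> ~~ odd i'.
    move=> o ax; apply: (@odd_sub_double _ (b x)); rewrite -ax.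
    by have /order_mulrz/dvdnP[q ->] := a0 x; rewrite oddM o andbF.
  rewrite (@ev 0 i) ?(@ev 1 j) ?(@ev 2%:R k) // (tnth_nth 0) /= ?o1 ?o2 ?o3 //.
  by rewrite oddM.
- by apply/eqP; rewrite -mulr2n xf o1.
- by apply/eqP; rewrite -mulr2n xf o2.
- by move=> j /eqP; rewrite -mulr2n -mulrnA xf o3 dvdn_pmul2l.
Qed.

End Bases.

(** * The three families *)

Lemma mset_seqP (T : choiceType) (S : {mset T}%mset) (L : seq T) :
  S = seq_mset L <-> perm_eq S L.
Proof.
split=> [->|p]; first exact: perm_eq_seq_mset.
by rewrite -[LHS]seq_mset_id; apply/eq_seq_msetP.
Qed.

Lemma free3_rev (a b c : V) : free3 a b c -> free3 c b a.
Proof. by move=> /free3_swap12/free3_swap23/free3_swap12. Qed.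

(** With a, b, c the classes of f1, f2, f3, these are the classes of f3 + d for the three d in <f1,
    f2> other than i f1 + j f2. *)
Lemma free3_shift (a b c : V) (i j : nat) : free3 a b c ->
  free3 (c + (a *+ i + b *+ j) + (a + b)) (c + (a *+ i + b *+ j) + a)
        (c + (a *+ i + b *+ j) + b).
Proof.
move=> fr; rewrite (mulVn a) (mulVn b); move: (odd i) (odd j) => {}i {}j.
have : all (fun a => all (fun b => all (fun c => free3 a b c ==>
  all (fun i : bool => all (fun j : bool =>
  free3 (c + (a *+ i + b *+ j) + (a + b)) (c + (a *+ i + b *+ j) + a)
        (c + (a *+ i + b *+ j) + b)) [:: true; false]) [:: true; false])
     allV) allV) allV.
  by vm_compute.
move=> /allP/(_ a (memV a))/allP/(_ b (memV b))/allP/(_ c (memV c))/implyP/(_ fr).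
by move=> /allP/(_ i) + ; case: i => /(_ isT)/allP/(_ j); case: j => /(_ isT).
Qed.

Lemma opp_involution (M : zmodType) (x : M) : x + x = 0 -> - x = x.
Proof. by move=> xx; apply/esym/eqP; rewrite -addr_eq0 xx. Qed.

Lemma gen_involutions (G : finZmodType) (x y d : G) :
  x + x = 0 -> y + y = 0 -> d \in <<[set x; y]>>%g ->
  exists i j : bool, d = x *+ i + y *+ j.
Proof.
move=> xx yy; pose H := [set x *+ i.1 + y *+ i.2 | i : (bool * bool)%type].
have gH : group_set H.
  apply/group_setP; split.
    by apply/imsetP; exists (false, false); rewrite // !mulr0n addr0.
  move=> _ _ /imsetP[[i j] _ ->] /imsetP[[i' j'] _ ->].
  apply/imsetP; exists (addb i i', addb j j') => //=.
  rewrite FinRing.zmodMgE addrACA.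
  by congr (_ + _); case: i i' j j' => [] [] [] []; rewrite ?mulr1n ?mulr0n ?addr0 ?add0r.
have : (<<[set x; y]>>%g \subset Group gH).
  rewrite gen_subG subUset !sub1set; apply/andP; split; apply/imsetP.
    by exists (true, false); rewrite // mulr1n mulr0n addr0.
  by exists (false, true); rewrite // mulr1n mulr0n add0r.
by move=> /subsetP sH /sH /imsetP[[i j] _ ->]; exists i, j.
Qed.

(** * From the three families to the normal form *)

Section ToNormalForm.
Variables (n : nat) (G : finZmodType) (cl : {additive G -> V}).
Hypotheses (n_gt1 : (1 < n)%N).
Variables (f1 f2 f3 : G).
Hypotheses (fr : free3 (cl f1) (cl f2) (cl f3)) (t1 : f1 + f1 = 0) (t2 : f2 + f2 = 0)
  (dbl : forall j, (f3 + f3) *+ j = 0 -> (n %| j)%N).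
Implicit Types (S : {mset G}%mset).

Lemma sub_mulz (f x : G) (k : nat) : x + x = 0 ->
  f - (f *~ k%:Z + x) = f *~ (1 - k%:Z) + x.
Proof. by move=> xx; rewrite mulrzBr mulr1z opprD addrA (opp_involution xx). Qed.

Lemma eta1_normal_form S : eta1 n f1 f2 f3 S ->
  exists f g h a b c, normal_form n cl S f g h a b c.
Proof.
move=> [v [a [/andP[_ vn] _ /mset_seqP pS]]].
(* The distinguished term f is f3 + f2, so that f - g = f2 and 2f = 2g. *)
exists (f3 + f2), f3, (f3 *~ a%:Z + f1), v, (n - 1 - v)%N, 0%N; split.
- have e1 : f3 + f2 - f3 = f2 by rewrite addrC addKr.
  have e2 : f3 + f2 - (f3 *~ a%:Z + f1) = f3 *~ (1 - a%:Z) + f2 + f1.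
    by rewrite addrAC (sub_mulz f3 a t1) addrAC.
  rewrite e1 e2 (_ : (2 * (n - 1 - v) + 1 = 2 * n - 1 - 2 * v)%N); last first.
    by clear -n_gt1 vn; lia.
  by perm_count.
- by clear -n_gt1 vn; lia.
- by split; [right; rewrite addrACA t2 addr0 | left].
- apply: free3_swap23; apply: free3_swap12.
  have := free3_comb a 1 (free3_rev fr).
  by rewrite -raddfMn mulr1n -!raddfD -pmulrn addrC (addrC f2).
- by move=> j; rewrite addrACA t2 addr0; apply: dbl.
Qed.

Lemma eta2_normal_form S : eta2 n f1 f2 f3 S ->
  exists f g h a b c, normal_form n cl S f g h a b c.
Proof.
move=> [a [b [_ _ _ /mset_seqP pS]]].
exists f3, (f3 *~ a%:Z + f2), (f3 *~ b%:Z + f1), (n - 1)%N, 0%N, 0%N; split=> //.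
- rewrite !sub_mulz // (_ : (2 * (n - 1) + 1 = 2 * n - 1)%N); last first.
    by clear -n_gt1; lia.
  by perm_count.
- by rewrite !addn0.
- by split; left.
- apply: free3_rev; have := free3_comb b a (free3_rev fr).
  by rewrite -!raddfMn -!raddfD -!pmulrn addrC (addrC f2).
Qed.

(* S' only contains the three elements of <f1, f2> different from its sum, and
   computing the sum shows that each of them has odd multiplicity. *)
Lemma eta3_normal_form S : eta3 n f1 f2 f3 S ->
  exists f g h a b c, normal_form n cl S f g h a b c.
Proof.
move=> [S' [szS' genS' sumS' /mset_seqP pS]].
set x := mset_sum S' in sumS'.
have /and4P[c1 c2 c3 /and3P[c12 _ _]] := fr.
have nz (y : G) : cl y != 0 -> y != 0 by apply: contraNneq => ->; rewrite raddf0.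
have xG : x \in <<[set f1; f2]>>%g.
  rewrite /x /mset_sum big_seq; elim/big_ind: _ => [|y z yin zin|y /genS' //].
    exact: group1.
  by rewrite -FinRing.zmodMgE groupM.
have [i [j ex]] := gen_involutions t1 t2 xG.
have xx : x + x = 0 by rewrite ex addrACA -!mulrnDl t1 t2 !mul0rn addr0.
have sub : {subset S' <= [:: x + (f1 + f2); x + f1; x + f2]}.
  move=> d dS'; have nd : d != x by apply: contraNneq sumS' => <-.
  have [k [l ed]] : exists k l : bool, d - x = f1 *+ k + f2 *+ l.
    apply: (gen_involutions t1 t2); rewrite (opp_involution xx) -FinRing.zmodMgE.
    by rewrite groupM //; apply: genS'.
  have {}ed : d = x + (f1 *+ k + f2 *+ l) by rewrite -ed addrC subrK.
  rewrite {}ed in nd *; move: nd.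
  by case: k l => [] []; rewrite ?mulr1n ?mulr0n ?addr0 ?add0r !inE ?eqxx ?orbT.
have uq : uniq [:: x + (f1 + f2); x + f1; x + f2].
  rewrite /= !inE !(inj_eq (addrI x)) negb_or andbT -andbA; apply/and3P; split.
  - by rewrite -subr_eq0 addrAC subrr add0r nz.
  - by rewrite -subr_eq0 addrK nz.
  - by rewrite -subr_eq0 (opp_involution t2) nz // raddfD.
have pS' := perm_nseq3 uq sub.
set p := count_mem _ _ in pS'; set q := count_mem _ _ in pS'; set r := count_mem _ _ in pS'.
clearbody p q r.
have pqr : (p + q + r = 2 * n + 1)%N.
  by rewrite -szS' (perm_size pS') !size_cat !size_nseq addnA.
(* As 2x = 0, the 2n + 1 copies of x in the sum of S' amount to x, so the rest vanishes. Hence p, q,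
   r have the same parity, which is odd because their sum is. *)
have /and3P[opq opr _] : [&& ~~ odd (p + q), ~~ odd (p + r) & ~~ odd 0].
  move/free3P: fr; apply; rewrite mulr0n addr0 -!(raddfMn cl) -(raddfD cl).
  suff -> : f1 *+ (p + q) + f2 *+ (p + r) = 0 by rewrite raddf0.
  apply: (addrI (x *+ (2 * n + 1))).
  rewrite addr0 {2}mulrnDr mulrnA mulr2n xx mul0rn add0r mulr1n.
  rewrite [RHS](_ : x = \sum_(d <- S') d) // (perm_big _ pS') /= !big_cat /= !sum_nseq -pqr.
  by rewrite !mulrnDr !mulrnDl !addrA [LHS](ACl (1*4*6*2*5*3*7)).
have [p' [q' [r' [ep eq er]]]] : exists p' q' r',
    [/\ p = (2 * p' + 1)%N, q = (2 * q' + 1)%N & r = (2 * r' + 1)%N].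
  exists p./2, q./2, r./2; clear -opq opr pqr; split; lia.
(* Taking d = x + f1 + f2 for f makes f - g = f2 and f - h = f1, the last two terms of S. *)
exists (f3 + (x + (f1 + f2))), (f3 + (x + f1)), (f3 + (x + f2)), p', q', r'.
have t12 : (f1 + f2) + (f1 + f2) = 0 by rewrite addrACA t1 t2 addr0.
have dd y : y + y = 0 -> (f3 + (x + y)) + (f3 + (x + y)) = f3 + f3.
  by move=> yy; rewrite addrACA (addrACA x) xx yy !addr0.
split.
- have aux (u v y z : G) : u + (v + (y + z)) - (u + (v + y)) = z.
    by rewrite !addrA [LHS]addrC addKr.
  have e1 := aux f3 x f1 f2.
  have e2 : f3 + (x + (f1 + f2)) - (f3 + (x + f2)) = f1 by rewrite (addrC f1) aux.
  have pm := perm_map (fun d => f3 + d) pS'.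
  rewrite !map_cat !map_nseq ep eq er in pm.
  by rewrite e1 e2; perm_count.
- by clear -pqr ep eq er; lia.
- by rewrite !dd //; split; right.
- have := free3_shift i j fr.
  by rewrite -!(raddfMn cl) -!(raddfD cl) -ex -!addrA.
- by move=> k; rewrite dd //; apply: dbl.
Qed.

End ToNormalForm.

(** * From the normal form to the three families *)

Section FromNormalForm.
Variables (n : nat) (G : finZmodType) (cl : {additive G -> V}).
Let K : {set G} := [set g | cl g == 0].
Hypotheses (n_gt1 : (1 < n)%N) (cardK : #|K| = n).
Hypothesis (exp2n : forall g : G, g *+ (2 * n) = 0).
Implicit Types (S : {mset G}%mset) (s : seq G) (f g h : G) (a b c : nat).

Lemma normal_form_swap s f g h a b c :
  normal_form n cl s f g h a b c -> normal_form n cl s f h g a c b.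
Proof.
move=> [ps abc [gb hc] fr dbl]; split=> //.
- by perm_count.
- by rewrite addnAC.
- exact: free3_swap23.
Qed.

(** For b = 0, g and f - g contribute one term each and are interchangeable. *)
Lemma normal_form_reflect s f g h a c :
  normal_form n cl s f g h a 0 c -> normal_form n cl s f (f - g) h a 0 c.
Proof.
move=> [ps abc [gb hc] fr dbl]; split=> //.
- by rewrite (subKr f g) muln0 /=; perm_count.
- by split=> //; left.
- apply: free3_rev; apply: free3_swap12.
  have := free3_comb 0 1 fr; rewrite mulr0n mulr1n addr0 raddfB oppV addrC (addrC (cl f)).
  by move/free3_swap12.
Qed.

Definition involutive_shift f g := g + g = f + f.
(** Equivalently 2(g - kf) = 0, with k in the range of the parameters of the families. *)
Definition multiple_shift f g k :=
  (2 <= k <= n - 1)%N /\ g + g = f *+ k + f *+ k.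

(* As 2g is a multiple of 2f, it equals 2kf with 0 <= k < n; the case k = 0
   becomes k = 1 when g and f - g are exchanged. *)
Lemma normal_form_reduce s f g h a b c : normal_form n cl s f g h a b c ->
  exists2 g', normal_form n cl s f g' h a b c &
    involutive_shift f g' \/ (b = 0%N /\ exists k, multiple_shift f g' k).
Proof.
move=> nf; have [_ _ [[b0|gg] _] _ dbl] := nf; last by exists g => //; left.
rewrite {}b0 in nf *.
have [|j ej] := kernel_multiple n_gt1 cardK dbl (x := g + g).
  by rewrite raddfD addVV.
have fn : (f + f) *+ n = 0 by rewrite -mulr2n -mulrnA exp2n.
have {ej} : g + g = (f + f) *+ (j %% n).
  by rewrite ej {1}(divn_eq j n) mulrnDr mulnC mulrnA fn mul0rn add0r.
have : (j %% n < n)%N by rewrite ltn_mod; clear -n_gt1; lia.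
move: (j %% n)%N => [|[|k]] kn ek.
- exists (f - g); first exact: normal_form_reflect.
  left; rewrite /involutive_shift addrACA -opprD ek mulr0n.
  by rewrite oppr0 addr0.
- by exists g => //; left; rewrite /involutive_shift ek mulr1n.
- exists g => //; right; split=> //; exists k.+2; split; last by rewrite ek mulrnDl.
  by clear -kn; lia.
Qed.

Lemma shifted_basis f g h i j :
  free3 (cl f) (cl g) (cl h) -> (forall k, (f + f) *+ k = 0 -> (n %| k)%N) ->
  g + g = f *+ j + f *+ j -> h + h = f *+ i + f *+ i ->
  let f1 := h - f *+ i in let f2 := g - f *+ j in
  [/\ is_basis [tuple f1; f2; f],
      [/\ #[f1]%g = 2%N, #[f2]%g = 2%N & #[f]%g = (2 * n)%N],
      f1 + f1 = 0 & f2 + f2 = 0].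
Proof.
move=> fr dbl gg hh f1 f2.
have t1 : f1 + f1 = 0 by rewrite addrACA -opprD hh subrr.
have t2 : f2 + f2 = 0 by rewrite addrACA -opprD gg subrr.
have [|B O] := free3_basis n_gt1 cardK exp2n _ t1 t2 dbl; last by split.
by rewrite !raddfB !(raddfMn cl) !oppV; apply: free3_comb.
Qed.

(** After reduction, two involutive shifts give (η3), exactly one gives (η1), and none gives
    (η2). *)
Lemma normal_form_eta S f g h a b c : normal_form n cl S f g h a b c ->
  exists f1 f2 f3 : G,
    [/\ is_basis [tuple f1; f2; f3],
        [/\ #[f1]%g = 2%N, #[f2]%g = 2%N & #[f3]%g = (2 * n)%N] &
        [\/ eta1 n f1 f2 f3 S, eta2 n f1 f2 f3 S | eta3 n f1 f2 f3 S]].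
Proof.
(* In the mixed case g', not f', becomes f3; since 2g' = 2f', the element h' - kg' is still killed
   by 2. *)
have TM f' g' h' a' b' k : normal_form n cl S f' g' h' a' b' 0 ->
    involutive_shift f' g' -> multiple_shift f' h' k ->
    exists f1 f2 f3 : G, [/\ is_basis [tuple f1; f2; f3],
        [/\ #[f1]%g = 2%N, #[f2]%g = 2%N & #[f3]%g = (2 * n)%N] & eta1 n f1 f2 f3 S].
  move=> [ps abc _ fr dbl] gg [kn hh].
  have [||||B O t1 t2] := @shifted_basis g' f' h' k 1.
  - exact: free3_swap12.
  - by move=> j; rewrite gg; apply: dbl.
  - by rewrite mulr1n.
  - by rewrite hh -!mulrnDl gg.
  exists (h' - g' *+ k), (f' - g' *+ 1), g'; split=> //.
  have e1 : f' = g' + (f' - g' *+ 1) by rewrite mulr1n addrC subrK.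
  have e2 : f' - g' = f' - g' *+ 1 by rewrite mulr1n.
  have e3 : h' = g' *~ k%:Z + (h' - g' *+ k) by rewrite -pmulrn addrC subrK.
  have e4 : f' - h' = g' *~ (1 - k%:Z) + (f' - g' *+ 1) + (h' - g' *+ k).
    rewrite {1}e1 {1}e3 addrAC (sub_mulz g' k t1).
    by rewrite addrAC.
  exists a', k; split=> //; first by clear -abc n_gt1; lia.
  apply/mset_seqP; rewrite -e1 -e3 -e4 -e2.
  rewrite (_ : (2 * n - 1 - 2 * a' = 2 * b' + 1)%N); last by clear -abc n_gt1; lia.
  by perm_count.
have MM f' g' h' k l : normal_form n cl S f' g' h' (n - 1) 0 0 -> (l <= k)%N ->
    multiple_shift f' g' k -> multiple_shift f' h' l ->
    exists f1 f2 f3 : G, [/\ is_basis [tuple f1; f2; f3],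
        [/\ #[f1]%g = 2%N, #[f2]%g = 2%N & #[f3]%g = (2 * n)%N] & eta2 n f1 f2 f3 S].
  move=> [ps abc _ fr dbl] lk [kn gg] [ln hh].
  have [B O t1 t2] := shifted_basis fr dbl gg hh.
  exists (h' - f' *+ l), (g' - f' *+ k), f'; split=> //.
  exists k, l; split=> //.
  rewrite -!sub_mulz // -!pmulrn !(addrC (f' *+ _)) !subrK.
  rewrite (_ : (2 * n - 1 = 2 * (n - 1) + 1)%N); last by clear -n_gt1; lia.
  by rewrite !muln0 !add0n /= in ps; apply/mset_seqP; perm_count.
move=> /normal_form_reduce[{}g nf] gT.
have [{nf} {}h /normal_form_swap nf hT] := normal_form_reduce (normal_form_swap nf).
case: gT hT => [gT|[b0 [k gM]]] [hT|[c0 [l hM]]].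
- have [ps abc _ fr dbl] := nf.
  have [||B O t1 t2] := @shifted_basis f g h 1 1 fr dbl; rewrite ?mulr1n //.
  rewrite !mulr1n in B O t1 t2.
  exists (h - f), (g - f), f; split=> //; apply: Or33.
  set f1 := h - f in B O t1 *; set f2 := g - f in B O t2 *.
  (* Subtracting f from f, g, h leaves 0, f2, f1 with odd multiplicities; their sum f1 + f2 is none
     of the three. *)
  pose L := nseq (2 * a + 1) 0 ++ nseq (2 * b + 1) f2 ++ nseq (2 * c + 1) f1.
  have pL := perm_eq_seq_mset L.
  have odd_mul (x : G) k : x + x = 0 -> x *+ (2 * k + 1) = x.
    by move=> xx; rewrite mulrnDr mulrnA mulr2n xx mul0rn add0r.
  have sumL : mset_sum (seq_mset L) = f1 + f2.
    rewrite /mset_sum (perm_big _ pL) /= !big_cat /= !sum_nseq mul0rn add0r.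
    by rewrite !odd_mul // addrC.
  have e1 : f + f1 = h by rewrite addrC subrK.
  have e2 : f + f2 = g by rewrite addrC subrK.
  have e3 : f - h = f1 by rewrite -(opp_involution t1) opprB.
  have e4 : f - g = f2 by rewrite -(opp_involution t2) opprB.
  exists (seq_mset L); split.
  - by rewrite (perm_size pL) !size_cat !size_nseq; clear -abc n_gt1; lia.
  - move=> d; rewrite (perm_mem pL) !mem_cat !mem_nseq => /or3P[] /andP[_ /eqP->].
    + exact: group1.
    + by rewrite mem_gen // !inE eqxx orbT.
    + by rewrite mem_gen // !inE eqxx.
  - have nz (x : G) : cl x != 0 -> x != 0 by apply: contraNneq => ->; rewrite raddf0.
    have /and4P[_ _ _ /and4P[fg fh gh _]] := fr.
    have n1 : f1 != 0 by rewrite nz // raddfB oppV addrC.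
    have n2 : f2 != 0 by rewrite nz // raddfB oppV addrC.
    have n12 : f1 + f2 != 0.
      by rewrite nz // /f1 /f2 addrACA -opprD raddfB raddfD [cl (f + f)]raddfD addVV subr0 addrC.
    rewrite sumL (perm_mem pL) !mem_cat !mem_nseq (negPf n12) andbF /=.
    by rewrite -subr_eq0 addrK (negPf n1) -subr_eq0 addrAC subrr add0r (negPf n2) !andbF.
  - apply/mset_seqP; have := perm_map (fun d => f + d) pL.
    rewrite !map_cat !map_nseq addr0 e1 e2 => pm.
    by rewrite e3 e4 in ps; perm_count.
- subst c; have [f1 [f2 [f3 [B O E]]]] := TM _ _ _ _ _ _ nf gT hM.
  by exists f1, f2, f3; split=> //; apply: Or31.
- subst b; have [f1 [f2 [f3 [B O E]]]] := TM _ _ _ _ _ _ (normal_form_swap nf) hT gM.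
  by exists f1, f2, f3; split=> //; apply: Or31.
- subst b c; have an : a = (n - 1)%N by have [_ + _ _ _] := nf; rewrite !addn0.
  subst a; have [lk|/ltnW lk] := leqP l k.
    have [f1 [f2 [f3 [B O E]]]] := MM _ _ _ _ _ nf lk gM hM.
    by exists f1, f2, f3; split=> //; apply: Or32.
  have [f1 [f2 [f3 [B O E]]]] := MM _ _ _ _ _ (normal_form_swap nf) lk hM gM.
  by exists f1, f2, f3; split=> //; apply: Or32.
Qed.

End FromNormalForm.

(** * Short zero-sum subsequences as multisets and as lists *)

Section ShortZeroSum.
Variables (n : nat) (G : finZmodType).
Hypothesis expG : exponent [set: G] = (2 * n)%N.
Implicit Types (S : {mset G}%mset).

Lemma no_short_not_has S : no_short_zero_sum n S -> ~ has_short_zero_sum S.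
Proof.
move=> ns [T [/msubsetP TS [T1 T2] T0]].
have pT : perm_eq (T ++ (S `\` T)%mset) S.
  apply/allP => x _ /=; apply/eqP.
  by rewrite count_cat !count_mem_mset msetE2 subnKC.
by have := ns _ _ pT; rewrite T1 -expG T2 => /(_ isT)/eqP; apply.
Qed.

(** Subsequences of S are given by masks, so the alternative is decided by a finite search. *)
Lemma has_short_or_no_short S : has_short_zero_sum S \/ no_short_zero_sum n S.
Proof.
have [/existsP[m /andP[sm /eqP m0]]|/existsPn nm] := boolP [exists m : (size S).-tuple bool,
  (0 < size (mask m S) <= 2 * n)%N && (\sum_(x <- mask m S) x == 0)].
  left; exists (seq_mset (mask m S)); have pm := perm_eq_seq_mset (mask m S).
  split.
  - apply/msubsetP => x; rewrite mset_seqE -(count_mem_mset x S).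
    by move: x; apply/count_subseqP; exists (mask m S); rewrite ?mask_subseq.
  - by rewrite /short (perm_size pm) expG; apply/andP.
  - by rewrite /mset_sum (perm_big _ pm).
right=> t u ptu szt; apply/negP => t0.
have [|w /subseqP[m sm ew] pw] := (count_subseqP t S).1.
  by move=> x; rewrite -(seq.permP ptu) count_cat leq_addr.
rewrite {}ew in pw; have smP : size m == size S by apply/eqP.
have := nm (Tuple smP).
by rewrite /= -(perm_size pw) szt -(perm_big _ pw) t0.
Qed.

End ShortZeroSum.

(** * Coordinates modulo 2 as a model of G / 2G *)

Section Parity.
Variables (n : nat) (G : finZmodType).
Variable phi : {additive G -> ('Z_2 * 'Z_2 * 'Z_(2 * n))%type}.

Definition parity_class (g : G) : V :=
  (odd (phi g).1.1, odd (phi g).1.2, odd (phi g).2).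

(** Reduction by an even modulus preserves parity; for m = 0 the actual modulus is 2. *)
Lemma odd_Zp_add m (x y : 'Z_(2 * m)) : odd (x + y)%R = odd x (+) odd y.
Proof.
rewrite -oddD /=; set k := (Zp_trunc (2 * m)).+2.
have ek : ~~ odd k by rewrite /k /Zp_trunc; clear; lia.
by rewrite [in RHS](divn_eq (x + y) k) oddD oddM (negPf ek) andbF.
Qed.

Lemma parity_class_is_zmod_morphism : zmod_morphism parity_class.
Proof.
have add x y : parity_class (x + y) = parity_class x + parity_class y.
  rewrite /parity_class raddfD /=.
  by congr (_, _, _); [apply: (@odd_Zp_add 1)..|apply: odd_Zp_add].
move=> x y; by rewrite -[in RHS](subrK y x) [in RHS]add addrK.
Qed.

HB.instance Definition _ := GRing.isZmodMorphism.Build G V parity_class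
  parity_class_is_zmod_morphism.

Hypotheses (n_gt1 : (1 < n)%N) (phi_bij : bijective phi).

Let two_n : (1 < 2 * n)%N.
Proof. by clear -n_gt1; lia. Qed.

Let lt_Zn (z : 'Z_(2 * n)) : (z < 2 * n)%N.
Proof. by rewrite -[X in (_ < X)%N](Zp_cast two_n) ltn_ord. Qed.

Lemma two_n_annihilates (g : G) : g *+ (2 * n) = 0.
Proof.
apply: (bij_inj phi_bij); rewrite raddfMn raddf0.
have Z2 (x : 'Z_2) : x *+ (2 * n) = 0.
  by rewrite -mulr_natr natrM (pchar_Zp (isT : (1 < 2)%N)) mul0r mulr0.
have Zn (x : 'Z_(2 * n)) : x *+ (2 * n) = 0.
  by rewrite -mulr_natr pchar_Zp ?mulr0.
move: (phi g) => [[x y] z].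
have -> k : ((x, y, z) : 'Z_2 * 'Z_2 * 'Z_(2 * n)) *+ k = (x *+ k, y *+ k, z *+ k).
  by elim: k => // k IH; rewrite !mulrS IH.
by rewrite !Z2 Zn.
Qed.

Let psi_nat (k : nat) : {g | phi g = (0, 0, k%:R)}.
Proof.
by have /sig_eqW : exists g, phi g = (0, 0, k%:R) by
  have [psi _ K] := phi_bij; exists (psi (0, 0, k%:R)).
Qed.

Lemma parity_kernel (g : G) : parity_class g = 0 ->
  exists2 k, (k < n)%N & phi g = (0, 0, (2 * k)%:R).
Proof.
rewrite /parity_class; case: (phi g) => [[x y] z] /= [/negbT ox /negbT oy /negbT oz].
have z2 (w : 'Z_2) : ~~ odd w -> w = 0.
  by case: w => [[|[|//]] lt] // _; apply: val_inj.
exists (z./2).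
  by have := lt_Zn z; clear; lia.
have e2 : (2 * z./2 = z)%N by rewrite [LHS]mul2n even_halfK.
rewrite (z2 x) // (z2 y) // e2; congr (_, _, _); apply: val_inj.
by rewrite /= val_Zp_nat // modn_small ?lt_Zn.
Qed.

Lemma parity_kernel_double (g : G) : parity_class g = 0 -> exists h, g = h + h.
Proof.
move=> /parity_kernel[k _ ek]; have [h eh] := psi_nat k.
exists h; apply: (bij_inj phi_bij); rewrite raddfD ek /= eh.
rewrite [RHS](_ : _ = (0 + 0, 0 + 0, k%:R + k%:R)) // !addr0 -natrD.
by rewrite addnn -mul2n.
Qed.

Lemma card_parity_kernel : #|[set g | parity_class g == 0]| = n.
Proof.
pose F (k : 'I_n) := sval (psi_nat (2 * k)).
have Finj : injective F.
  move=> i j /(congr1 phi); rewrite /F (svalP (psi_nat _)) (svalP (psi_nat _)) => -[].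
  move=> /(congr1 val); rewrite /= !val_Zp_nat //.
  have := ltn_ord i; have := ltn_ord j => lj li.
  rewrite !modn_small; [|by clear -li lj; lia..] => e.
  by apply: val_inj => /=; clear -e; lia.
rewrite -[RHS]card_ord -cardsT -(card_imset _ Finj); congr #|pred_of_set _|.
apply/setP => g; rewrite inE; apply/eqP/imsetP => [/parity_kernel[k kn ek]|[k _ ->]].
  exists (Ordinal kn) => //; apply: (bij_inj phi_bij).
  by rewrite ek /F (svalP (psi_nat _)).
rewrite /parity_class /F (svalP (psi_nat _)) /= val_Zp_nat //.
rewrite modn_small; last by have := ltn_ord k => lk; clear -lk; lia.
by rewrite mul2n odd_double.
Qed.

(** This sequence of length 2n + 3 supplies the lower bound for eta. *)
Lemma exists_normal_form : exists f g h, forall s,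
  perm_eq s (nseq (2 * (n - 1) + 1) f ++ [:: g; h; f - g; f - h]) ->
  normal_form n (parity_class : {additive G -> V}) s f g h (n - 1) 0 0.
Proof.
have [psi _ K] := phi_bij.
pose f := psi (0, 0, 1); pose g := psi (0, 1, 1); pose h := psi (1, 0, 1).
exists f, g, h => s ps; split=> //.
- by rewrite !addn0.
- by split; left.
- rewrite /= /parity_class !K /=.
  by vm_compute.
- move=> j /(congr1 phi); rewrite raddfMn raddfD raddf0 K.
  have -> : (((0, 0, 1) : 'Z_2 * 'Z_2 * 'Z_(2 * n)) + (0, 0, 1)) *+ j = (0, 0, (2 * j)%:R).
    rewrite -mulr2n -mulrnA; elim: (2 * j)%N => // k IH.
    by rewrite mulrS IH mulrS; congr (_, _, _); rewrite ?addr0.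
  move=> [] /(congr1 val); rewrite /= val_Zp_nat // => /eqP.
  by rewrite -/(dvdn _ _) dvdn_pmul2l.
Qed.

End Parity.

Theorem theorem4p1 (n : nat) (G : finZmodType)
    (phi : {additive G -> ('Z_2 * 'Z_2 * 'Z_(2 * n))%type}) :
  (2 <= n)%N -> bijective phi ->
  is_eta G (2 * n + 4) /\
  forall S : {mset G}%mset, size S = (2 * n + 3)%N ->
    (~ has_short_zero_sum S <->
     exists f1 f2 f3 : G,
       [/\ is_basis [tuple f1; f2; f3],
           [/\ #[f1]%g = 2%N, #[f2]%g = 2%N & #[f3]%g = (2 * n)%N] &
           [\/ eta1 n f1 f2 f3 S, eta2 n f1 f2 f3 S | eta3 n f1 f2 f3 S]]).
Proof.
move=> n_gt1 phi_bij.
pose cl : {additive G -> V} := parity_class phi.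
have cardK : #|[set g | cl g == 0]| = n by apply: card_parity_kernel.
have exp2n := two_n_annihilates n_gt1 phi_bij.
have ker2 g : cl g = 0 -> exists h, g = h + h by apply: parity_kernel_double.
have [f [g [h nf]]] := exists_normal_form n_gt1 phi_bij.
have expG : exponent [set: G] = (2 * n)%N.
  apply/eqP; rewrite eqn_dvd; apply/andP; split.
    by apply/exponentP => x _; rewrite FinRing.zmodXgE exp2n.
  have [_ _ _ /and3P[f0 _ _] dbl] := nf _ (perm_refl _).
  by rewrite -(order_double exp2n dbl f0); apply: dvdn_exponent; rewrite inE.
split; first split.
- move=> S sS; have [//|ns] := has_short_or_no_short expG S.
  by have := size_no_short n_gt1 cardK ns; rewrite ltnNge sS.
(* For a smaller m, the hypothesis would apply to the normal form of length 2n + 3. *)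
- move=> m hm; rewrite leqNgt; apply/negP => mlt.
  pose S := seq_mset (nseq (2 * (n - 1) + 1) f ++ [:: g; h; f - g; f - h]).
  have pS : perm_eq S _ := perm_eq_seq_mset _.
  apply: (no_short_not_has expG (normal_form_no_short n_gt1 (nf S pS))).
  apply: hm; rewrite (perm_size pS) size_cat size_nseq /=.
  by clear -mlt n_gt1; lia.
move=> S sS; split=> [nhs|[f1 [f2 [f3 [B [o1 o2 o3] E]]]]].
  have [//|ns] := has_short_or_no_short expG S.
  have [|f' [g' [h' [a [b [c nf']]]]]] := normal_form_exists n_gt1 cardK exp2n ns.
    by rewrite sS.
  exact: (normal_form_eta n_gt1 cardK exp2n nf').
have [fr t1 t2 dbl] := basis_free3 ker2 B o1 o2 o3.
have [f' [g' [h' [a [b [c nf']]]]]] : exists f g h a b c, normal_form n cl S f g h a b c.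
  case: E.
  - exact: (eta1_normal_form n_gt1 fr).
  - exact: (eta2_normal_form n_gt1 fr).
  - exact: (eta3_normal_form fr).
exact: (no_short_not_has expG (normal_form_no_short n_gt1 nf')).
Qed.
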